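(* Let $A$ be an abelian group whose torsion subgroup is infinite. Then there is a Hausdorff group topology $\tau$ on $A$ such that $(A,\tau)$ is almost maximally almost-periodic, i.e., the von Neumann radical $\mathbf{n}(A,\tau)$ is non-trivial and finite.
   Context: For a topological group $G$, let $\rho_G\colon G\to bG$ be the Bohr compactification, i.e., the continuous homomorphism into a compact Hausdorff group $bG$ through which every continuous homomorphism of $G$ into a compact Hausdorff group factors uniquely. The von Neumann radical of $G$ is $\mathbf{n}(G)=\ker\rho_G$. For an abelian topological group $G$ one has $\mathbf{n}(G)=\bigcap_{\chi\in\hat G}\ker\chi$, where $\hat G$ is the group of all continuous homomorphisms $\chi\colon G\to\mathbb{T}=\mathbb{R}/\mathbb{Z}$. A Hausdorff topological group $G$ is called almost maximally almost-periodic if $\mathbf{n}(G)$ is non-trivial but finite. *)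

(* Defs.v *)
(* MathComp / MathComp-Analysis. *)
From HB Require Import structures.
From mathcomp Require Import all_boot all_order all_algebra.
From mathcomp Require Import all_classical topology.

Set Implicit Arguments.
Unset Strict Implicit.
Unset Printing Implicit Defensive.

Local Open Scope classical_set_scope.
Local Open Scope group_scope.

(* A topology on G is a term tau : Topological G, and (G, tau) is the
   topologicalType Topological.Pack tau.  The class Topological G also carries
   an eqType/choiceType structure on G; it plays no role below (classically
   every type has one). *)
Definition space (G : Type) (tau : Topological G) : topologicalType :=
  Topological.Pack tau.

Definition group_topology (G : groupType) (tau : Topological G) : Prop :=
  continuous ((fun xy => (xy.1 : G) * (xy.2 : G))
                : space tau * space tau -> space tau) /\
  continuous ((fun x => (x : G)^-1) : space tau -> space tau).

Definition hausdorff_group_topology (G : groupType) (tau : Topological G) :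
    Prop :=
  group_topology tau /\ hausdorff_space (space tau).

Definition compact_hausdorff_group_topology (G : groupType)
    (tau : Topological G) : Prop :=
  hausdorff_group_topology tau /\ compact [set: space tau].

Definition continuous_hom (G H : groupType) (tau : Topological G)
    (sigma : Topological H) (f : G -> H) : Prop :=
  {morph f : x y / x * y} /\ continuous (f : space tau -> space sigma).

(* K ranges over all compact Hausdorff groups, abelian or not. *)
Definition is_bohr_compactification (G : groupType) (tau : Topological G)
    (bG : groupType) (sigma : Topological bG) (rho : G -> bG) : Prop :=
  [/\ compact_hausdorff_group_topology sigma,
      continuous_hom tau sigma rho &
      forall (K : groupType) (kappa : Topological K),
        compact_hausdorff_group_topology kappa ->
        forall f : G -> K, continuous_hom tau kappa f ->
        exists! g : bG -> K, continuous_hom sigma kappa g /\ g \o rho = f].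

(* The kernel of rho : G -> bG.  The Bohr compactification being determined only
   up to isomorphism, the kernels of all its models are intersected; they
   coincide, see von_neumann_radicalE. *)
Definition von_neumann_radical (G : groupType) (tau : Topological G) : set G :=
  [set x | forall (bG : groupType) (sigma : Topological bG) (rho : G -> bG),
             is_bohr_compactification tau sigma rho -> rho x = 1].

Lemma von_neumann_radicalE (G : groupType) (tau : Topological G)
    (bG : groupType) (sigma : Topological bG) (rho : G -> bG) :
  is_bohr_compactification tau sigma rho ->
  von_neumann_radical tau = [set x | rho x = 1].
Proof.
move=> bohr; apply/seteqP; split=> x /=; first by move=> xn; exact: xn bohr.
move=> rhox1 bG' sigma' rho' [cpt' hom' _].
have [_ _ /(_ _ _ cpt' _ hom') [g [[[gM _] <-] _]]] := bohr.
rewrite /= rhox1; apply: (@mulgI _ (g 1)).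
by rewrite -gM !mulg1.
Qed.

Definition almost_maximally_almost_periodic (G : groupType)
    (tau : Topological G) : Prop :=
  [/\ hausdorff_group_topology tau,
      von_neumann_radical tau <> [set 1] &
      finite_set (von_neumann_radical tau)].

Definition torsion_subgroup (A : zmodType) : set A :=
  [set x | exists2 n : nat, (0 < n)%N & (x *+ n = 0)%R].

Arguments torsion_subgroup : clear implicits.

(* Main.v *)
Require Import Defs.
From HB Require Import structures.
From mathcomp Require Import all_boot all_order all_algebra finmap.
From mathcomp Require Import all_classical reals topology normedtype.
From mathcomp Require Import complex ring lra zify.
From mathcomp Require Import Rstruct.
Import Defs.
Import Order.TTheory GRing.Theory Num.Theory.
Import numFieldNormedType.Exports.
Import ComplexField.Normc.

(** Why every abelian group A with infinite torsion has such a topology.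

    Fix a nonzero torsion element e0.  The topology makes the elements
    e0 + (s u - s v) small, where s is a family of torsion elements indexed by
    the finite sequences of natural numbers and u -> v is an edge of the shift
    graph: u = (x_0, ..., x_m), v = (x_1, ..., x_(m+1)) with x increasing.  Such
    an element gets the cost 3 / (m + 1), and an element of A is small when it
    is a signed sum of these generators of small total cost.

    The radical contains e0.  A compact group K is covered by finitely many
    translates of a neighbourhood of 1, so a homomorphism f to K colours each
    u by the translate that contains f (s u).  A finite colouring of a shift
    graph has monochromatic edges between arbitrarily long sequences
    (monochromatic_edge).  On such an edge f (s v - s u) is close to 1, and if
    f is continuous then it is also close to f e0.  Hence f e0 = 1
    (compactification_map_kills).

    No nonzero multiple of e0 is small.  The shift graph has no short
    unbalanced cycles: for few edges on long sequences there is an integer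
    potential on the vertices that drops by exactly 1 along each of these
    edges (potential_edge).  Suppose that a word of cost less than 1 in the
    generators equals a multiple of e0.  If the family s is independent
    enough, the total coefficient of each s v in the word annihilates e0; the
    sum of these coefficients against the potential is the total coefficient of
    e0 in the word, so the word is 0 (multiple_in_unit_ball_eq0).

    Everything outside <e0> is separated from 0 by continuous characters.  The
    family s lives in a countable infinite torsion group B.  Countably many
    characters of A that kill e0 separate the points of B / <e0>; by compactness
    of the circle B has infinitely many elements on which finitely many of these
    characters are close to 1, so s can be chosen independent with all these
    characters small on s v for long v (exists_independent_family).  Such
    characters, and the characters trivial on B, are Lipschitz for the cost and
    therefore continuous.  It follows that the topology is Hausdorff and that its
    radical lies in the finite group <e0>.

    The last step uses that the kernel of a Bohr compactification lies in the
    kernel of every continuous homomorphism to a compact group, which has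
    content only if a Bohr compactification exists.  It is
    constructed here as a completion, for arbitrary topologized groups
    (is_bohr_compactification_bohr). *)

Set Implicit Arguments.
Unset Strict Implicit.
Unset Printing Implicit Defensive.

Local Open Scope classical_set_scope.
Local Open Scope ring_scope.

(** * Existence of the Bohr compactification *)

Lemma fmap_ultra (X Y : Type) (f : X -> Y) (F : set_system X) :
  UltraFilter F -> UltraFilter (f @ F).
Proof.
move=> FU; split=> [|H HF FH]; first exact: fmap_proper_filter.
apply/seteqP; split=> [A HA|]; last exact: FH.
have [//|FA] := in_ultra_setVsetC (f @^-1` A) FU.
have : H (A `&` ~` A) by apply: filterI HA _; exact: FH.
by rewrite setICr => /filter_not_empty.
Qed.

Section CompactificationMaps.
Local Open Scope group_scope.
Context (G : groupType) (tau : Topological G).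

Definition compactification_map (K : groupType) (kappa : Topological K)
    (f : G -> K) : Prop :=
  compact_hausdorff_group_topology kappa /\ continuous_hom tau kappa f.

Definition tends (X : Type) (F : set_system X) (K : Type)
    (kappa : Topological K) (f : X -> K) (k : K) : Prop :=
  forall U : set K, nbhs (k : space kappa) U -> F (f @^-1` U).

Lemma tends_unique (X : Type) (F : set_system X) (K : Type)
    (kappa : Topological K) (f : X -> K) (k k' : K) :
  ProperFilter F -> hausdorff_space (space kappa) ->
  tends F kappa f k -> tends F kappa f k' -> k = k'.
Proof.
move=> FF hK fk fk'; apply: hK => U V Uk Vk'.
have [x [Ux Vx]] := filter_ex (filterI (fk _ Uk) (fk' _ Vk')).
by exists (f x).
Qed.

Lemma tendsM (F1 F2 : set_system G) (F : set_system G) (K : groupType)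
    (kappa : Topological K) (f : G -> K) (k1 k2 : K) :
  compactification_map kappa f ->
  (forall P Q N, F1 P -> F2 Q -> (forall x y, P x -> Q y -> N (x * y)) -> F N) ->
  tends F1 kappa f k1 -> tends F2 kappa f k2 -> tends F kappa f (k1 * k2).
Proof.
move=> [[[[cM _] _] _] [fM _]] FM fk1 fk2 U /(cM (k1, k2)) [[V W] /= [Vk Wk] sVW].
apply: FM (fk1 _ Vk) (fk2 _ Wk) _ => x y Vx Wy /=.
by rewrite fM; apply: (sVW (f x, f y)).
Qed.

Lemma group_hom1 (K : groupType) (f : G -> K) : {morph f : x y / x * y} -> f 1 = 1.
Proof. by move=> fM; apply: (@mulgI _ (f 1)); rewrite -fM !mulg1. Qed.

Lemma group_homV (K : groupType) (f : G -> K) : {morph f : x y / x * y} ->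
  {morph f : x / x^-1}.
Proof.
by move=> fM x; apply: (@mulgI _ (f x)); rewrite -fM !mulgV group_hom1.
Qed.

(** A filter is required to converge along every continuous homomorphism to a
    compact Hausdorff group.  The quantification over all groups K is harmless
    in a proposition, so no set of representatives of the K has to be chosen. *)
Definition bohr_cauchy (F : set_system G) : Prop :=
  ProperFilter F /\
  forall (K : groupType) (kappa : Topological K) (f : G -> K),
    compactification_map kappa f -> exists k, tends F kappa f k.

Definition same_limits (F F' : set_system G) : Prop :=
  forall (K : groupType) (kappa : Topological K) (f : G -> K) (k : K),
    compactification_map kappa f -> tends F kappa f k -> tends F' kappa f k.

(** A point of the completion is a class of Cauchy filters with the same limits,
    represented by its least element; with this normal form points with equal
    limits are equal (bohr_ext), and no quotient is taken. *)
Record bohr := Bohr {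
  bohr_filter : set_system G;
  bohr_filter_cauchy : bohr_cauchy bohr_filter;
  bohr_filter_min : forall F, bohr_cauchy F -> same_limits bohr_filter F ->
    bohr_filter `<=` F }.

HB.instance Definition _ := gen_eqMixin bohr.
HB.instance Definition _ := gen_choiceMixin bohr.

Definition bohr_lift (K : groupType) (kappa : Topological K) (f : G -> K)
    (b : bohr) : K :=
  xget 1 [set k | tends (bohr_filter b) kappa f k].

Lemma tends_bohr_lift (K : groupType) (kappa : Topological K) (f : G -> K) b :
  compactification_map kappa f ->
  tends (bohr_filter b) kappa f (bohr_lift kappa f b).
Proof.
move=> fP; have [k fk] := (bohr_filter_cauchy b).2 _ _ _ fP.
exact: (@xgetPex _ 1 [set k | tends (bohr_filter b) kappa f k]) (ex_intro _ k fk).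
Qed.

Arguments tends_bohr_lift {K kappa f}.

Lemma bohr_liftE (K : groupType) (kappa : Topological K) (f : G -> K) b k :
  compactification_map kappa f ->
  tends (bohr_filter b) kappa f k -> bohr_lift kappa f b = k.
Proof.
move=> fP bk; have [[[_ hK] _] _] := fP.
have bF := (bohr_filter_cauchy b).1.
exact: (tends_unique bF hK (tends_bohr_lift b fP) bk).
Qed.

Lemma bohr_ext (b b' : bohr) :
  (forall (K : groupType) (kappa : Topological K) (f : G -> K),
     compactification_map kappa f ->
     bohr_lift kappa f b = bohr_lift kappa f b') -> b = b'.
Proof.
move=> bb'; have sub (c c' : bohr) :
    (forall (K : groupType) (kappa : Topological K) (f : G -> K),
      compactification_map kappa f ->
      bohr_lift kappa f c = bohr_lift kappa f c') ->
    bohr_filter c `<=` bohr_filter c'.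
  move=> cc'; apply: bohr_filter_min (bohr_filter_cauchy c') _.
  move=> K kappa f k fP /(bohr_liftE fP) <-; rewrite cc' //.
  exact: tends_bohr_lift.
have : bohr_filter b = bohr_filter b'.
  by apply/seteqP; split; apply: sub => // *; rewrite bb'.
case: b b' {sub bb'} => [F Fc Fm] [F' Fc' Fm'] /= FF'.
case: F' / FF' Fc' Fm' => Fc' Fm'; congr Bohr; exact: Prop_irrelevance.
Qed.

(** The least Cauchy filter with the limits of F is the intersection of all of
    them. *)
Lemma bohr_of_cauchy (F : set_system G) : bohr_cauchy F ->
  exists b : bohr,
    forall (K : groupType) (kappa : Topological K) (f : G -> K) k,
      compactification_map kappa f -> tends F kappa f k ->
      bohr_lift kappa f b = k.
Proof.
move=> Fc.
pose H : set_system G :=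
  [set N | forall F', bohr_cauchy F' -> same_limits F F' -> F' N].
have FH : same_limits F H.
  by move=> K kappa f k fP Ff U Uk F' _ FF'; exact: FF' Ff _ Uk.
have Hc : bohr_cauchy H.
  split; last first.
    by move=> K kappa f fP; have [k Fk] := Fc.2 _ _ _ fP; exists k; exact: FH.
  split; first by move=> /(_ F Fc) H0; case: (Fc.1) => F0 _; apply: F0; exact: H0.
  split=> [F' [F'P _] _|P Q HP HQ F' Fc' FF'|P Q PQ HP F' Fc' FF'].
  - exact: filterT.
  - have F'P := Fc'.1; exact: filterI (HP _ Fc' FF') (HQ _ Fc' FF').
  - have F'P := Fc'.1; exact: filterS PQ (HP _ Fc' FF').
have Hm F' : bohr_cauchy F' -> same_limits H F' -> H `<=` F'.
  move=> Fc' HF' N HN; apply: HN Fc' _ => K kappa f k fP Fk.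
  exact: HF' fP (FH _ _ _ _ fP Fk).
exists (Bohr Hc Hm) => K kappa f k fP Fk.
exact: (bohr_liftE (b := Bohr Hc Hm) fP (FH _ _ _ _ fP Fk)).
Qed.

Lemma bohr_of_subproof (x : G) : exists b : bohr, forall (K : groupType)
  (kappa : Topological K) (f : G -> K), compactification_map kappa f ->
  bohr_lift kappa f b = f x.
Proof.
pose F : set_system G := [set N | N x].
have Ft (K : groupType) (kappa : Topological K) (f : G -> K) :
  tends F kappa f (f x) by move=> U /nbhs_singleton.
have Fc : bohr_cauchy F.
  split; last by move=> K kappa f fP; exists (f x).
  by split=> //; split=> // P Q PQ; exact: PQ.
by have [b bP] := bohr_of_cauchy Fc; exists b => K kappa f fP; exact: bP.
Qed.

(** The group operations are obtained by unique choice: they are determined by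
    their images under all bohr_lift, which also yields the group axioms. *)
Definition to_bohr (x : G) : bohr := projT1 (cid (bohr_of_subproof x)).

Lemma bohr_lift_to_bohr (K : groupType) (kappa : Topological K) (f : G -> K) x :
  compactification_map kappa f -> bohr_lift kappa f (to_bohr x) = f x.
Proof. by move=> fP; rewrite /to_bohr; case: cid => /= b ->. Qed.

Lemma bohr_mul_subproof (b c : bohr) : exists d : bohr, forall (K : groupType)
  (kappa : Topological K) (f : G -> K), compactification_map kappa f ->
  bohr_lift kappa f d = bohr_lift kappa f b * bohr_lift kappa f c.
Proof.
pose F : set_system G := [set N | exists P Q, [/\ bohr_filter b P,
  bohr_filter c Q & forall x y, P x -> Q y -> N (x * y)]].
have Ft (K : groupType) (kappa : Topological K) (f : G -> K) :
    compactification_map kappa f ->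
    tends F kappa f (bohr_lift kappa f b * bohr_lift kappa f c).
  move=> fP; apply: tendsM (tends_bohr_lift b fP) (tends_bohr_lift c fP) => //.
  by move=> P Q N bP cQ PQN; exists P, Q.
have bF := (bohr_filter_cauchy b).1; have cF := (bohr_filter_cauchy c).1.
have Fc : bohr_cauchy F.
  split; last by move=> K kappa f fP; eexists; exact: Ft.
  split.
    move=> [P [Q [bP cQ PQ]]].
    have [x Px] := filter_ex bP; have [y Qy] := filter_ex cQ.
    exact: PQ Px Qy.
  split.
  - by exists setT, setT; split=> //; exact: filterT.
  - move=> M N [P [Q [bP cQ PQ]]] [P' [Q' [bP' cQ' PQ']]].
    exists (P `&` P'), (Q `&` Q'); split; [exact: filterI| exact: filterI|].
    by move=> x y [Px P'x] [Qy Q'y]; split; [exact: PQ|exact: PQ'].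
  - move=> M N MN [P [Q [bP cQ PQ]]]; exists P, Q; split=> // x y Px Qy.
    by apply: MN; exact: PQ.
have [d dP] := bohr_of_cauchy Fc; exists d => K kappa f fP.
by apply: dP => //; exact: Ft.
Qed.

Lemma bohr_inv_subproof (b : bohr) : exists d : bohr, forall (K : groupType)
  (kappa : Topological K) (f : G -> K), compactification_map kappa f ->
  bohr_lift kappa f d = (bohr_lift kappa f b)^-1.
Proof.
have bF := (bohr_filter_cauchy b).1.
pose F : set_system G := [set N | bohr_filter b [set x | N x^-1]].
have Ft (K : groupType) (kappa : Topological K) (f : G -> K) :
    compactification_map kappa f ->
    tends F kappa f (bohr_lift kappa f b)^-1.
  move=> fP; have [[[[_ cV] _] _] [fM _]] := fP.
  move=> U /cV Uk; rewrite /F /=.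
  by apply: filterS (tends_bohr_lift b fP _ Uk) => x; rewrite /= (group_homV fM).
have Fc : bohr_cauchy F.
  split; last by move=> K kappa f fP; eexists; exact: Ft.
  split; first exact: filter_not_empty.
  split=> [|M N FM FN|M N MN FM].
  - exact: filterT.
  - exact: filterI FM FN.
  - by apply: filterS FM => x; exact: MN.
have [d dP] := bohr_of_cauchy Fc; exists d => K kappa f fP.
by apply: dP => //; exact: Ft.
Qed.

Definition bohr_mul b c : bohr := projT1 (cid (bohr_mul_subproof b c)).
Definition bohr_inv b : bohr := projT1 (cid (bohr_inv_subproof b)).

Lemma bohr_lift_mul (K : groupType) (kappa : Topological K) (f : G -> K) b c :
  compactification_map kappa f ->
  bohr_lift kappa f (bohr_mul b c) = bohr_lift kappa f b * bohr_lift kappa f c.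
Proof. by move=> fP; rewrite /bohr_mul; case: cid => /= d ->. Qed.

Lemma bohr_lift_inv (K : groupType) (kappa : Topological K) (f : G -> K) b :
  compactification_map kappa f ->
  bohr_lift kappa f (bohr_inv b) = (bohr_lift kappa f b)^-1.
Proof. by move=> fP; rewrite /bohr_inv; case: cid => /= d ->. Qed.

Lemma bohr_lift_one (K : groupType) (kappa : Topological K) (f : G -> K) :
  compactification_map kappa f -> bohr_lift kappa f (to_bohr 1) = 1.
Proof.
by move=> fP; rewrite bohr_lift_to_bohr // group_hom1 //; case: fP => _ [].
Qed.

Lemma bohr_mulA : associative bohr_mul.
Proof. by move=> b c d; apply: bohr_ext => *; rewrite !bohr_lift_mul // mulgA. Qed.

Lemma bohr_mul1b : left_id (to_bohr 1) bohr_mul.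
Proof.
by move=> b; apply: bohr_ext => *; rewrite bohr_lift_mul // bohr_lift_one // mul1g.
Qed.

Lemma bohr_mulb1 : right_id (to_bohr 1) bohr_mul.
Proof.
by move=> b; apply: bohr_ext => *; rewrite bohr_lift_mul // bohr_lift_one // mulg1.
Qed.

Lemma bohr_mulVb : left_inverse (to_bohr 1) bohr_inv bohr_mul.
Proof.
move=> b; apply: bohr_ext => *.
by rewrite bohr_lift_mul // bohr_lift_one // bohr_lift_inv // mulVg.
Qed.

Lemma bohr_mulbV : right_inverse (to_bohr 1) bohr_inv bohr_mul.
Proof.
move=> b; apply: bohr_ext => *.
by rewrite bohr_lift_mul // bohr_lift_one // bohr_lift_inv // mulgV.
Qed.

HB.instance Definition _ := isGroup.Build bohr bohr_mulA bohr_mul1b bohr_mulb1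
  bohr_mulVb bohr_mulbV.

(** The topology is the initial one for the maps bohr_lift.  Its neighbourhoods
    of b are the sets common to all filters that converge to b after each
    bohr_lift; this gives filters without intersecting finitely many
    preimages, which would need products of the target groups. *)
Definition bohr_cvg (Phi : set_system bohr) (b : bohr) : Prop :=
  forall (K : groupType) (kappa : Topological K) (f : G -> K),
    compactification_map kappa f ->
    tends Phi kappa (bohr_lift kappa f) (bohr_lift kappa f b).

Definition bohr_nbhs (b : bohr) : set_system bohr :=
  [set N | forall Phi, Filter Phi -> bohr_cvg Phi b -> Phi N].

HB.instance Definition _ := hasNbhs.Build bohr bohr_nbhs.

Lemma bohr_nbhsE (b : bohr) (N : set bohr) : nbhs b N =
  forall Phi, Filter Phi -> bohr_cvg Phi b -> Phi N.
Proof. by []. Qed.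

Lemma bohr_nbhs_cvg b : bohr_cvg (nbhs b) b.
Proof.
move=> K kappa f fP U Uk; change (bohr_nbhs b (bohr_lift kappa f @^-1` U)).
by move=> Phi _ Phib; exact: Phib.
Qed.

Lemma bohr_nbhs_singleton (b : bohr) (N : set bohr) : nbhs b N -> N b.
Proof.
rewrite bohr_nbhsE => /(_ [set S | S b]); apply.
  by split=> // P Q; exact.
by move=> K kappa f fP U /nbhs_singleton.
Qed.

Lemma bohr_nbhs_filter (b : bohr) : ProperFilter (nbhs b).
Proof.
split; first exact: bohr_nbhs_singleton.
split=> [|P Q|P Q PQ]; rewrite !bohr_nbhsE.
- by move=> Phi PhiF _; exact: filterT.
- by move=> bP bQ Phi PhiF Phib; exact: filterI (bP _ _ Phib) (bQ _ _ Phib).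
- by move=> bP Phi PhiF Phib; exact: filterS PQ (bP _ _ Phib).
Qed.

Lemma bohr_nbhs_nbhs (b : bohr) (N : set bohr) : nbhs b N -> nbhs b (nbhs^~ N).
Proof.
rewrite !bohr_nbhsE => bN Phi PhiF Phib.
(* Psi still converges to b, because each lift is continuous at the points of
   an open preimage; so N belongs to Psi. *)
pose Psi : set_system bohr := [set S | Phi (nbhs^~ S)].
have bF := bohr_nbhs_filter.
have PsiF : Filter Psi.
  split=> [|P Q PP PQ|P Q PQ PP]; rewrite /Psi /=.
  - by apply: filterE => c; exact: filterT.
  - have PPQ : Phi (nbhs^~ P `&` nbhs^~ Q) by exact: filterI.
    apply: (filterS _ PPQ) => c [cP cQ]; have cF := bF c.
    exact: (@filterI _ (nbhs c) _ P Q cP cQ).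
  - apply: (filterS _ (PP : Phi _)) => c cP; have cF := bF c.
    exact: (@filterS _ (nbhs c) _ P Q PQ cP).
apply: (bN Psi PsiF) => K kappa f fP U Uk; rewrite /Psi /=.
apply: filterS (Phib _ _ _ fP _ (nbhs_interior Uk)) => c Uc.
exact: bohr_nbhs_cvg fP _ Uc.
Qed.

HB.instance Definition _ := Nbhs_isNbhsTopological.Build bohr bohr_nbhs_filter
  bohr_nbhs_singleton bohr_nbhs_nbhs.

End CompactificationMaps.

Section BohrCompactification.
Local Open Scope group_scope.
Context (G : groupType) (tau : Topological G).
Notation bohr := (bohr tau).

Definition bohr_topology : Topological bohr := Topological.on bohr.

Lemma bohr_liftM (K : groupType) (kappa : Topological K) (f : G -> K) :
  compactification_map tau kappa f ->
  {morph (bohr_lift kappa f : bohr -> K) : b c / b * c}.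
Proof. by move=> fP b c; exact: bohr_lift_mul. Qed.

Lemma bohr_liftV (K : groupType) (kappa : Topological K) (f : G -> K) :
  compactification_map tau kappa f ->
  {morph (bohr_lift kappa f : bohr -> K) : b / b^-1}.
Proof. by move=> fP b; exact: bohr_lift_inv. Qed.

Lemma bohr_lift_continuous (K : groupType) (kappa : Topological K)
    (f : G -> K) : compactification_map tau kappa f ->
  continuous (bohr_lift kappa f : space bohr_topology -> space kappa).
Proof. by move=> fP b U; exact: bohr_nbhs_cvg. Qed.

Lemma bohr_hausdorff : hausdorff_space bohr.
Proof.
move=> b c bc; apply: bohr_ext => K kappa f fP.
have [[[_ hK] _] _] := fP; apply: hK => U V Ub Vc.
have := bc _ _ (bohr_nbhs_cvg fP Ub) (bohr_nbhs_cvg fP Vc).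
by case=> d [Ud Vd]; exists (bohr_lift kappa f d).
Qed.

Lemma bohr_group_topology : group_topology bohr_topology.
Proof.
split.
  move=> [b c] N /=; rewrite [X in X -> _]bohr_nbhsE; apply.
  move=> K kappa f fP U; rewrite bohr_liftM //.
  have [[[[cM _] _] _] _] := fP.
  move=> /(cM (_, _)) [[V W] /= [Vb Wc] sVW].
  exists (bohr_lift kappa f @^-1` V, bohr_lift kappa f @^-1` W) => /=.
    by split; exact: bohr_nbhs_cvg.
  move=> [b' c'] /= [Vb' Wc']; rewrite bohr_liftM //.
  exact: (sVW (_, _)).
move=> b N; rewrite [X in X -> _]bohr_nbhsE; apply.
  exact: (@fmap_filter _ _ _ (nbhs b) (nbhs_filter b)).
move=> K kappa f fP U; rewrite bohr_liftV //.
have [[[[_ cV] _] _] _] := fP.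
move=> /cV Ub; have := bohr_nbhs_cvg fP Ub.
by apply: (@filterS _ _ (nbhs_filter (b : bohr))) => c; rewrite /= bohr_liftV.
Qed.

(** An ultrafilter Phi of points has a limit along each lift, since the targets
    are compact.  Averaging over Phi the filters that represent the points gives
    a Cauchy filter on G with the same limits. *)
Lemma bohr_compact : compact [set: bohr].
Proof.
rewrite compact_ultra => Phi PhiU _.
pose F : set_system G := [set N | Phi [set b | bohr_filter b N]].
have bF (b : bohr) := (bohr_filter_cauchy b).1.
have FF : ProperFilter F.
  split.
    rewrite /F /= => F0; apply: (filter_not_empty Phi); apply: filterS F0 => b.
    exact: filter_not_empty.
  split=> [|P Q FP FQ|P Q PQ FP]; rewrite /F /=.
  - by apply: filterE => b; exact: filterT.
  - have FPQ : Phi ([set b | bohr_filter b P] `&` [set b | bohr_filter b Q]).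
      exact: filterI.
    by apply: filterS FPQ => b [bP bQ]; exact: filterI.
  - by apply: (filterS _ (FP : Phi _)) => b; exact: filterS.
have limP (K : groupType) (kappa : Topological K) (f : G -> K) :
    compactification_map tau kappa f ->
    exists2 k, tends Phi kappa (bohr_lift kappa f) k & tends F kappa f k.
  move=> fP; have [[_ cptK] _] := fP.
  have fPhiU : UltraFilter ((bohr_lift kappa f : bohr -> space kappa) @ Phi).
    exact: fmap_ultra.
  move: cptK; rewrite compact_ultra => /(_ _ fPhiU filterT) [k [_ Phik]].
  exists k; first by move=> U; exact: Phik.
  move=> U /nbhs_interior /Phik PhiU'; rewrite /F /=.
  apply: (filterS _ (PhiU' : Phi _)) => b Ub; exact: tends_bohr_lift fP _ Ub.
have Fc : bohr_cauchy tau F.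
  split=> // K kappa f fP.
  by have [k _ Fk] := limP _ _ _ fP; exists k.
have [b bP] := bohr_of_cauchy Fc.
exists b; split=> // N; rewrite bohr_nbhsE; apply.
by move=> K kappa f fP; have [k Phik Fk] := limP _ _ _ fP; rewrite (bP _ _ _ _ fP Fk).
Qed.

Lemma to_bohrM : {morph (to_bohr tau : G -> bohr) : x y / x * y}.
Proof.
move=> x y; apply: bohr_ext => K kappa f fP; rewrite bohr_liftM //.
by rewrite !bohr_lift_to_bohr //; case: fP => _ [].
Qed.

Lemma to_bohr_continuous :
  continuous (to_bohr tau : space tau -> space bohr_topology).
Proof.
move=> x N; rewrite [X in X -> _]bohr_nbhsE; apply.
move=> K kappa f fP U; rewrite bohr_lift_to_bohr //.
have [_ [_ cf]] := fP => /cf.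
apply: (@filterS _ _ (nbhs_filter (x : space tau))) => y /= Uy.
by rewrite bohr_lift_to_bohr.
Qed.

(** The image of G is dense: the filter of b, pushed to the completion,
    converges to b.  This is what makes extensions unique. *)
Lemma to_bohr_cvg (b : bohr) N : nbhs b N -> bohr_filter b (to_bohr tau @^-1` N).
Proof.
have bF := (bohr_filter_cauchy b).1.
rewrite bohr_nbhsE => /(_ (to_bohr tau @ bohr_filter b)); apply.
move=> K kappa f fP U /(tends_bohr_lift fP).
by apply: filterS => x Ux; rewrite /= bohr_lift_to_bohr.
Qed.

Lemma is_bohr_compactification_bohr :
  is_bohr_compactification tau bohr_topology (to_bohr tau).
Proof.
split.
- split; last exact: bohr_compact.
  by split; [exact: bohr_group_topology|exact: bohr_hausdorff].
- by split; [exact: to_bohrM|exact: to_bohr_continuous].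
move=> K kappa kP f fhom; have fP : compactification_map tau kappa f by [].
exists (bohr_lift kappa f); split.
  split; last by apply/funext => x; exact: bohr_lift_to_bohr.
  by split; [exact: bohr_liftM|exact: bohr_lift_continuous].
move=> g [[_ cg] gf]; apply/funext => b; apply: bohr_liftE => // U /cg gU.
have := to_bohr_cvg gU; congr (bohr_filter b _); rewrite -gf //.
Qed.

Lemma von_neumann_radical_compactification (K : groupType)
    (kappa : Topological K) (f : G -> K) x :
  compactification_map tau kappa f -> von_neumann_radical tau x -> f x = 1.
Proof.
move=> fP /(_ _ _ _ is_bohr_compactification_bohr) x1.
have fP' := bohr_lift_to_bohr x fP.
by rewrite -fP' x1; apply: group_hom1; exact: bohr_liftM.
Qed.

End BohrCompactification.

(** * The circle group *)

Section Circle.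
Context (R : realType).

Record circle := Circle { circle_val :> R[i]; circle_valP : normc circle_val == 1 }.
HB.instance Definition _ := [isSub for circle_val].
HB.instance Definition _ := [Choice of circle by <:].

Implicit Types z w : circle.

Lemma normc_circle z : normc (val z) = 1.
Proof. by case: z => z /= /eqP. Qed.

Fact circle_mul_subproof z w : normc (val z * val w) == 1.
Proof. by rewrite normcM !normc_circle mulr1. Qed.

Fact circle_inv_subproof z : normc (val z)^-1 == 1.
Proof. by rewrite normcV normc_circle invr1. Qed.

Fact circle_one_subproof : normc (1 : R[i]) == 1.
Proof. by rewrite normc1. Qed.

Definition circle_mul z w : circle := Circle (circle_mul_subproof z w).
Definition circle_inv z : circle := Circle (circle_inv_subproof z).
Definition circle_one : circle := Circle circle_one_subproof.

Lemma circle_neq0 z : val z != 0.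
Proof.
by apply/eqP => z0; have /eqP := normc_circle z; rewrite z0 normc0 eq_sym oner_eq0.
Qed.

Fact circle_mulA : associative circle_mul.
Proof. by move=> x y z; apply: val_inj; rewrite /= mulrA. Qed.
Fact circle_mul1z : left_id circle_one circle_mul.
Proof. by move=> x; apply: val_inj; rewrite /= mul1r. Qed.
Fact circle_mulz1 : right_id circle_one circle_mul.
Proof. by move=> x; apply: val_inj; rewrite /= mulr1. Qed.
Fact circle_mulVz : left_inverse circle_one circle_inv circle_mul.
Proof. by move=> x; apply: val_inj; rewrite /= mulVf // circle_neq0. Qed.
Fact circle_mulzV : right_inverse circle_one circle_inv circle_mul.
Proof. by move=> x; apply: val_inj; rewrite /= mulfV // circle_neq0. Qed.

HB.instance Definition _ := isGroup.Build circle circle_mulA circle_mul1z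
  circle_mulz1 circle_mulVz circle_mulzV.

(** The circle gets the topology of the plane. *)
Definition ReIm z : R * R := (complex.Re (val z), complex.Im (val z)).

HB.instance Definition _ := Topological.copy circle (initial_topology ReIm).

Definition circle_topology : Topological circle := Topological.on circle.

Lemma ReIm_continuous : continuous ReIm.
Proof. exact: initial_continuous. Qed.

Lemma Re_continuous : continuous (fun z => complex.Re (val z)).
Proof. by move=> z; apply: (cvg_comp ReIm fst (@ReIm_continuous z)); exact: cvg_fst. Qed.

Lemma Im_continuous : continuous (fun z => complex.Im (val z)).
Proof. by move=> z; apply: (cvg_comp ReIm snd (@ReIm_continuous z)); exact: cvg_snd. Qed.

Lemma ReIm_sqr z : (ReIm z).1 ^+ 2 + (ReIm z).2 ^+ 2 = 1.
Proof.
have := normc_circle z; rewrite /ReIm /=; case: (val z) => a b /= ab.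
by rewrite -[RHS](expr1n _ 2) -ab sqr_sqrtr // addr_ge0 // sqr_ge0.
Qed.

Lemma ReIm_inj : injective ReIm.
Proof.
move=> [[a b] zP] [[c d] wP]; rewrite /ReIm /= => -[ac bd]; apply: val_inj => /=.
by rewrite ac bd.
Qed.

Lemma circle_hausdorff : hausdorff_space circle.
Proof.
move=> z w zw; apply: ReIm_inj.
have cR := @Re_continuous; have cI := @Im_continuous.
rewrite /ReIm; congr pair; apply: (@Rhausdorff R) => U V Uz Vw.
  by have [x [Ux Vx]] := zw _ _ (cR z _ Uz) (cR w _ Vw); exists (complex.Re (val x)).
by have [x [Ux Vx]] := zw _ _ (cI z _ Uz) (cI w _ Vw); exists (complex.Im (val x)).
Qed.

Lemma continuous_to_circle (X : topologicalType) (f : X -> circle) :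
  continuous (fun x => complex.Re (val (f x))) ->
  continuous (fun x => complex.Im (val (f x))) -> continuous f.
Proof.
move=> cR cI; apply: (@continuous_comp_initial _ X _ ReIm) => x.
exact: (cvg_pair (cR x) (cI x)).
Qed.

Lemma circle_group_topology : group_topology circle_topology.
Proof.
have cR1 : continuous (fun xy : circle * circle => complex.Re (val xy.1)).
  move=> x; exact: (cvg_comp fst (fun z : circle => complex.Re (val z))
    cvg_fst (@Re_continuous x.1)).
have cR2 : continuous (fun xy : circle * circle => complex.Re (val xy.2)).
  move=> x; exact: (cvg_comp snd (fun z : circle => complex.Re (val z))
    cvg_snd (@Re_continuous x.2)).
have cI1 : continuous (fun xy : circle * circle => complex.Im (val xy.1)).
  move=> x; exact: (cvg_comp fst (fun z : circle => complex.Im (val z))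
    cvg_fst (@Im_continuous x.1)).
have cI2 : continuous (fun xy : circle * circle => complex.Im (val xy.2)).
  move=> x; exact: (cvg_comp snd (fun z : circle => complex.Im (val z))
    cvg_snd (@Im_continuous x.2)).
split; apply: continuous_to_circle.
- have -> : (fun xy : space circle_topology * space circle_topology =>
      complex.Re (val ((xy.1 : circle) * xy.2)%g)) =
    (fun xy : circle * circle => complex.Re (val xy.1) * complex.Re (val xy.2)
       - complex.Im (val xy.1) * complex.Im (val xy.2)).
    by apply/funext => -[[[a b] ?] [[c d] ?]].
  by move=> x; apply: cvgB; apply: cvgM; [exact: cR1|exact: cR2|exact: cI1|exact: cI2].
- have -> : (fun xy : space circle_topology * space circle_topology =>
      complex.Im (val ((xy.1 : circle) * xy.2)%g)) =
    (fun xy : circle * circle => complex.Re (val xy.1) * complex.Im (val xy.2)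
       + complex.Im (val xy.1) * complex.Re (val xy.2)).
    by apply/funext => -[[[a b] ?] [[c d] ?]].
  by move=> x; apply: cvgD; apply: cvgM; [exact: cR1|exact: cI2|exact: cI1|exact: cR2].
- have -> : (fun z : space circle_topology => complex.Re (val (z : circle)^-1%g))
     = (fun z : circle => complex.Re (val z)).
    apply/funext => z; have := ReIm_sqr z; rewrite /ReIm /=.
    by case: z => -[a b] ? /= ->; rewrite divr1.
  exact: Re_continuous.
- have -> : (fun z : space circle_topology => complex.Im (val (z : circle)^-1%g))
     = (fun z : circle => - complex.Im (val z)).
    apply/funext => z; have := ReIm_sqr z; rewrite /ReIm /=.
    by case: z => -[a b] ? /= ->; rewrite divr1.
  move=> z; exact: (cvgN (@Im_continuous z)).
Qed.

Lemma circle_compact : compact [set: circle].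
Proof.
rewrite compact_ultra => Phi PhiU _.
have PU : UltraFilter (ReIm @ Phi) by exact: fmap_ultra.
have : compact (`[-1 : R, 1] `*` `[-1 : R, 1]).
  by apply: compact_setX; exact: segment_compact.
have bd z : (`[-1 : R, 1] `*` `[-1 : R, 1]) (ReIm z).
  have := ReIm_sqr z; case: (ReIm z) => a b /= ab.
  by split; rewrite /= in_itv /=; apply/andP; split; nra.
rewrite compact_ultra => /(_ _ PU (filterE _ bd)) [[a b] [_ pP]].
have ca : complex.Re (val z) @[z --> Phi] --> a.
  exact: (cvg_comp ReIm fst pP cvg_fst).
have cb : complex.Im (val z) @[z --> Phi] --> b.
  exact: (cvg_comp ReIm snd pP cvg_snd).
have ab : a * a + b * b = 1.
  have c1 : (fun z : circle => complex.Re (val z) * complex.Re (val z) +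
      complex.Im (val z) * complex.Im (val z)) @ Phi --> a * a + b * b.
    exact: (cvgD (cvgM ca ca) (cvgM cb cb)).
  have E : (fun z : circle => complex.Re (val z) * complex.Re (val z) +
      complex.Im (val z) * complex.Im (val z)) = fun=> 1.
    by apply/funext => z; rewrite -[RHS](ReIm_sqr z) !expr2.
  rewrite E in c1; 
  have c2 : (fun=> 1 : R) @ Phi --> (1 : R) by exact: cvg_cst.
  have PF : ProperFilter ((fun=> 1 : R) @ Phi) by exact: fmap_proper_filter.
  exact: (@cvg_unique _ (@Rhausdorff R) _ PF _ _ c1 c2).
have zP : normc (a +i* b)%C == 1 by rewrite /= !expr2 ab sqrtr1.
exists (Circle zP); split=> // N [_ [[U oU <-] Uz] sUN].
by apply: filterS sUN _; apply: pP; exact: open_nbhs_nbhs.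
Qed.

Lemma normc_le (x y : R) : normc (x +i* y)%C <= `|x| + `|y|.
Proof.
rewrite /= -[leRHS]ger0_norm ?addr_ge0 // -sqrtr_sqr ler_sqrt ?sqr_ge0 //.
have := mulr_ge0 (normr_ge0 x) (normr_ge0 y).
by rewrite sqrrD !real_normK ?num_real // mulr2n; lra.
Qed.

Lemma Re_le_normc (x : R[i]) : `|complex.Re x| <= normc x.
Proof.
case: x => a b /=; rewrite -sqrtr_sqr ler_sqrt ?addr_ge0 ?sqr_ge0 //.
by rewrite lerDl sqr_ge0.
Qed.

Lemma Im_le_normc (x : R[i]) : `|complex.Im x| <= normc x.
Proof.
case: x => a b /=; rewrite -sqrtr_sqr ler_sqrt ?addr_ge0 ?sqr_ge0 //.
by rewrite lerDr sqr_ge0.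
Qed.

Lemma nbhs_circle z (N : set circle) :
  nbhs z N <-> exists2 e : R, 0 < e &
    forall w, normc (val w - val z) < e -> N w.
Proof.
split.
  have cR := @Re_continuous; have cI := @Im_continuous.
  move=> [_ [[U oU <-] Uz] sUN].
  have [[e1 e2] /= [e10 e20] e1e2U] : nbhs (ReIm z) U by exact: open_nbhs_nbhs.
  move: e10 e20 => /nbhs_ballP[r1 /= r10 sr1] /nbhs_ballP[r2 /= r20 sr2].
  exists (Num.min r1 r2); first by rewrite lt_min r10.
  move=> w; rewrite lt_min => /andP[zw1 zw2]; apply: sUN; apply: e1e2U; split.
    apply: sr1; apply: le_lt_trans zw1; rewrite distrC.
    by apply: le_trans (Re_le_normc _); rewrite raddfB.
  apply: sr2; apply: le_lt_trans zw2; rewrite distrC.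
  by apply: le_trans (Im_le_normc _); rewrite raddfB.
move=> [e e0 eN].
have e20 : 0 < e / 2 by rewrite divr_gt0.
have zR : nbhs z [set w | `|complex.Re (val z) - complex.Re (val w)| < e / 2].
  exact: (@Re_continuous z _ (nbhsx_ballx _ _ e20)).
have zI : nbhs z [set w | `|complex.Im (val z) - complex.Im (val w)| < e / 2].
  exact: (@Im_continuous z _ (nbhsx_ballx _ _ e20)).
apply: (filterS _ (filterI zR zI)) => w [wR wI]; apply: eN.
have -> : val w - val z = ((complex.Re (val w) - complex.Re (val z)) +i*
    (complex.Im (val w) - complex.Im (val z)))%C.
  by case: (val w) (val z) => a b [c d].
apply: le_lt_trans (normc_le _ _) _; rewrite [e]splitr ltrD //.
  by rewrite distrC.
by rewrite distrC.
Qed.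

End Circle.

(** * Characters of abelian groups *)

Section Characters.
Context (R : realType) (A : zmodType).
Notation C := R[i].

Definition character (chi : A -> C) : Prop :=
  (forall x, normc (chi x) = 1) /\ {morph chi : x y / x + y >-> x * y}.

Definition subgroup (H : set A) : Prop :=
  H 0 /\ forall x y, H x -> H y -> H (x - y).

Lemma subgroupN (H : set A) x : subgroup H -> H x -> H (- x).
Proof. by move=> [H0 HB] Hx; rewrite -[- x]add0r; exact: HB. Qed.

Lemma subgroupD (H : set A) x y : subgroup H -> H x -> H y -> H (x + y).
Proof.
by move=> sH Hx Hy; rewrite -[y]opprK; apply: sH.2 => //; exact: subgroupN.
Qed.

Lemma subgroupMn (H : set A) x n : subgroup H -> H x -> H (x *+ n).
Proof.
move=> sH Hx; elim: n => [|n IH]; first by rewrite mulr0n; exact: sH.1.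
by rewrite mulrS; exact: subgroupD.
Qed.

Lemma subgroupMz (H : set A) x (n : int) : subgroup H -> H x -> H (x *~ n).
Proof.
move=> sH Hx; case: n => n; first by rewrite -pmulrn; exact: subgroupMn.
by rewrite NegzE mulrNz -pmulrn; apply: subgroupN => //; exact: subgroupMn.
Qed.

Lemma exists_root (n : nat) (z : C) : (0 < n)%N -> exists w, w ^+ n = z.
Proof.
move=> n0; have [w wE] := @solve_monicpoly C n (fun i => if i == 0%N then z else 0) n0.
exists w; rewrite wE; case: n n0 {wE} => // n _.
by rewrite big_ord_recl /= expr0 mulr1 big1 ?addr0 // => i _; rewrite mul0r.
Qed.

Lemma exists_root_of_unity (n : nat) : (1 < n)%N ->
  exists2 z : C, z != 1 & z ^+ n = 1.
Proof.
case: n => [|[|n]] // _.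
have [w wP] := @solve_monicpoly C n.+1 (fun=> -1) isT.
have w0 : \sum_(i < n.+2) w ^+ i = 0.
  rewrite big_ord_recr /= wP -[X in X + _]mul1r mulr_sumr -big_split /=.
  by rewrite big1 // => i _; rewrite mul1r mulN1r subrr.
exists w; last first.
  by apply/eqP; rewrite -subr_eq0 subrX1 w0 mulr0.
apply: contra_eq_neq w0 => ->; under eq_bigr do rewrite expr1n.
by rewrite sumr_const card_ord pnatr_eq0.
Qed.

Lemma normcX (z : C) n : normc (z ^+ n) = normc z ^+ n.
Proof. by elim: n => [|n IH]; rewrite ?normc1 // !exprS normcM IH. Qed.

Lemma normc_exprz (z : C) (n : int) : normc z = 1 -> normc (z ^ n) = 1.
Proof.
move=> z1; case: n => n; first by rewrite -exprnP normcX z1 expr1n.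
by rewrite NegzE -exprz_inv -exprnP normcX normcV z1 invr1 expr1n.
Qed.

Lemma normc_root (z w : C) n : (0 < n)%N -> w ^+ n = z -> normc z = 1 ->
  normc w = 1.
Proof.
move=> n0 <-; rewrite normcX => /eqP; rewrite pexpr_eq1 //; first by move/eqP.
by case: w => a b; rewrite sqrtr_ge0.
Qed.

Lemma normc1_neq0 (z : C) : normc z = 1 -> z != 0.
Proof.
by move=> z1; apply/eqP => z0; move/eqP: z1; rewrite z0 normc0 eq_sym oner_eq0.
Qed.

(** Graphs of characters of subgroups of A.  By the closure under
    quotients, the last clause makes the relation functional. *)
Definition partial_character (Gamma : set (A * C)) : Prop :=
  [/\ Gamma (0, 1),
      forall x y z w, Gamma (x, z) -> Gamma (y, w) -> Gamma (x - y, z / w),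
      forall x z, Gamma (x, z) -> normc z = 1 &
      forall z, Gamma (0, z) -> z = 1].

Lemma partial_character_uniq Gamma x z w : partial_character Gamma ->
  Gamma (x, z) -> Gamma (x, w) -> z = w.
Proof.
move=> [G0 GB Gn G1] Gz Gw; have := GB _ _ _ _ Gz Gw; rewrite subrr => /G1 zw.
have w0 := normc1_neq0 (Gn _ _ Gw).
by apply: (@mulIf _ w^-1); rewrite ?invr_eq0 // zw divff.
Qed.

Lemma partial_characterD Gamma x y z w : partial_character Gamma ->
  Gamma (x, z) -> Gamma (y, w) -> Gamma (x + y, z * w).
Proof.
move=> [G0 GB _ _] Gx Gy; have := GB _ _ _ _ Gx (GB _ _ _ _ G0 Gy).
by rewrite sub0r opprK div1r invrK.
Qed.

Lemma partial_characterMz Gamma x z (n : int) : partial_character Gamma ->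
  Gamma (x, z) -> Gamma (x *~ n, z ^ n).
Proof.
move=> pG Gx; have [G0 GB _ _] := pG.
have Gn m : Gamma (x *+ m, z ^+ m).
  elim: m => [|m IH]; first by rewrite mulr0n.
  by rewrite mulrS exprS; exact: partial_characterD.
case: n => n; first by rewrite -pmulrn -exprnP.
rewrite NegzE mulrNz -pmulrn -exprz_inv -exprnP exprVn.
by rewrite -sub0r -div1r; exact: GB.
Qed.

(** The values zeta at a that allow an extension of Gamma to a. *)
Definition compatible (Gamma : set (A * C)) a (zeta : C) : Prop :=
  normc zeta = 1 /\ forall (n : int) t, Gamma (a *~ n, t) -> zeta ^ n = t.

Definition extend (Gamma : set (A * C)) a (zeta : C) : set (A * C) :=
  [set p | exists x z (n : int),
     Gamma (x, z) /\ p = (x + a *~ n, z * zeta ^ n)].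

Lemma extend_sub Gamma a zeta : Gamma `<=` extend Gamma a zeta.
Proof. by move=> [x z] Gx; exists x, z, 0; rewrite mulr0z addr0 expr0z mulr1. Qed.

Lemma extend_mem Gamma a zeta : Gamma (0, 1) -> extend Gamma a zeta (a, zeta).
Proof. by move=> G0; exists 0, 1, 1; rewrite mulr1z add0r expr1z mul1r. Qed.

Lemma partial_character_extend Gamma a zeta : partial_character Gamma ->
  compatible Gamma a zeta -> partial_character (extend Gamma a zeta).
Proof.
move=> pG [zeta1 comp]; have [G0 GB Gn G1] := pG.
have zeta0 := normc1_neq0 zeta1.
split.
- exact: extend_sub.
- move=> _ _ _ _ [x [z [n [Gx [-> ->]]]]] [y [w [m [Gy [-> ->]]]]].
  exists (x - y), (z / w), (n - m); split; first exact: GB.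
  rewrite mulrzBr expfzDr // -invr_expz opprD addrACA; congr pair.
  by rewrite invfM mulrACA.
- move=> _ _ [x [z [n [Gx [_ ->]]]]].
  by rewrite normcM (Gn _ _ Gx) normc_exprz // mulr1.
- move=> _ [x [z [n [Gx [xn ->]]]]].
  have : Gamma (a *~ n, z^-1).
    have -> : a *~ n = 0 - x by rewrite xn addrAC subrr add0r.
    by rewrite -div1r; exact: GB.
  move=> /comp ->; rewrite mulfV //; exact: normc1_neq0 (Gn _ _ Gx).
Qed.

Lemma compatible_free Gamma a zeta : partial_character Gamma ->
  normc zeta = 1 ->
  (forall m t, (0 < m)%N -> ~ Gamma (a *+ m, t)) -> compatible Gamma a zeta.
Proof.
move=> [G0 GB Gn G1] zeta1 free; split=> // -[[|n]|n] t.
- by rewrite mulr0z expr0z => /G1 ->.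
- by rewrite -pmulrn => Gt; case: (free n.+1 t isT Gt).
- rewrite NegzE mulrNz -pmulrn => Gt; exfalso.
  have := GB _ _ _ _ G0 Gt; rewrite sub0r opprK; exact: (free n.+1).
Qed.

Lemma compatible_root Gamma a zeta m : partial_character Gamma ->
  (0 < m)%N -> Gamma (a *+ m, zeta ^+ m) ->
  (forall k t, (0 < k)%N -> Gamma (a *+ k, t) -> (m <= k)%N) ->
  compatible Gamma a zeta.
Proof.
move=> pG m0 Gm min; have [G0 GB Gn G1] := pG.
have zeta1 : normc zeta = 1 by apply: normc_root m0 _ (Gn _ _ Gm).
have zeta0 := normc1_neq0 zeta1.
split=> // n t Gt.
have m0' : (m : int) != 0 by rewrite eqz_nat -lt0n.
set q := (n %/ m)%Z; set r := (n %% m)%Z.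
have nE : n = q * m + r by exact: divz_eq.
have r0 : 0 <= r by exact: modz_ge0.
have rm : r < m by rewrite -[X in _ < X]/(`|m%:Z|); exact: ltz_mod.
have Gq : Gamma (a *~ (q * m), zeta ^ (q * m)).
  have := partial_characterMz q pG Gm.
  by rewrite pmulrn mulrzAC -mulrzA exprnP exprzAC exprz_exp.
have Gr : Gamma (a *~ r, t / zeta ^ (q * m)).
  by have := GB _ _ _ _ Gt Gq; rewrite -mulrzBr nE addrAC subrr add0r.
have rE : r = 0.
  case: r r0 rm Gr {nE} => [[|r]|r] // _ rm; rewrite -pmulrn => /min -/(_ isT).
  by rewrite leqNgt; move: rm; rewrite ltz_nat => ->.
rewrite nE rE addr0; rewrite rE mulr0z in Gr; have tE := G1 _ Gr.
by rewrite -[RHS](@divfK _ (zeta ^ (q * m))) ?expfz_neq0 // tE mul1r.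
Qed.

(** If some multiple of a lies in the domain, zeta is a root of the value at the
    least one; otherwise zeta is free.  This is divisibility of the circle. *)
Lemma exists_compatible Gamma a : partial_character Gamma ->
  exists zeta, compatible Gamma a zeta.
Proof.
move=> pG.
have [[m [t [m0 Gm]]]|free] := pselect (exists m t, (0 < m)%N /\ Gamma (a *+ m, t)).
  have ex : exists m, `[< (0 < m)%N /\ exists t, Gamma (a *+ m, t) >].
    by exists m; apply/asboolP; split=> //; exists t.
  case: (ex_minnP ex) => k /asboolP [k0 [u Gk]] kmin.
  have [zeta zetak] := exists_root u k0; exists zeta.
  apply: (compatible_root pG k0); first by rewrite zetak.
  move=> j v j0 Gj; apply: kmin; apply/asboolP; split=> //; by exists v.
exists 1; apply: compatible_free => //; first exact: normc1.
by move=> m t m0 Gm; apply: free; exists m, t.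
Qed.

(** Zorn's lemma, applied to the graphs D for which Gamma together with D is a
    partial character, so that the empty chain is no exception. *)
Lemma extend_partial_character Gamma : partial_character Gamma ->
  exists2 chi, character chi & forall x z, Gamma (x, z) -> chi x = z.
Proof.
move=> pG.
pose P := [set D : set (A * C) | partial_character (Gamma `|` D)].
have [|D [DP Dmax]] := @Zorn_bigcup _ P.
  move=> F FP Ftot.
  have chain p q : (Gamma `|` \bigcup_(X in F) X) p ->
      (Gamma `|` \bigcup_(X in F) X) q ->
      exists D, [/\ partial_character D, D p, D q &
        D `<=` Gamma `|` \bigcup_(X in F) X].
    have sub X : F X -> Gamma `|` X `<=` Gamma `|` \bigcup_(X in F) X.
      by move=> FX r [Gr|Xr]; [left|right; exists X].
    move=> [Gp|[X FX Xp]] [Gq|[Y FY Yq]].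
    - by exists Gamma; split=> // r; left.
    - by exists (Gamma `|` Y); split; [exact: FP|left|right|exact: sub].
    - by exists (Gamma `|` X); split; [exact: FP|right|left|exact: sub].
    - have [XY|YX] := Ftot _ _ FX FY.
        by exists (Gamma `|` Y); split; [exact: FP|right; exact: XY|right|exact: sub].
      by exists (Gamma `|` X); split; [exact: FP|right|right; exact: YX|exact: sub].
  split.
  - by left; case: pG.
  - move=> x y z w xz yw; have [D [[_ DB _ _] Dx Dy sD]] := chain _ _ xz yw.
    exact/sD/DB.
  - move=> x z xz; have [D [[_ _ Dn _] Dx _ _]] := chain _ _ xz xz; exact: Dn Dx.
  - move=> z z0; have [D [[_ _ _ D1] Dz _ _]] := chain _ _ z0 z0; exact: D1.
have total x : exists z, (Gamma `|` D) (x, z).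
  have [zeta comp] := exists_compatible x DP.
  have pE := partial_character_extend DP comp.
  have xE : extend (Gamma `|` D) x zeta (x, zeta) by apply: extend_mem; case: DP.
  have sE : Gamma `|` D `<=` extend (Gamma `|` D) x zeta by exact: extend_sub.
  apply: contrapT => nx; apply: (Dmax (extend (Gamma `|` D) x zeta)).
    split; first by move=> p Dp; apply: sE; right.
    by move=> /(_ _ xE) Dx; apply: nx; exists zeta; right.
  have -> : P (extend (Gamma `|` D) x zeta) =
      partial_character (extend (Gamma `|` D) x zeta).
    rewrite /P /=; congr partial_character; apply/setUidPr.
    by move=> p Gp; apply: sE; left.
  exact: pE.
have /choice [chi chiP] := total; exists chi.
  split=> [x|x y]; first by have [_ _ Dn _] := DP; exact: Dn (chiP x).
  exact: partial_character_uniq DP (chiP _) (partial_characterD DP (chiP x) (chiP y)).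
by move=> x z Gx; apply: partial_character_uniq DP (chiP x) _; left.
Qed.

Lemma separating_character (H : set A) a : subgroup H -> ~ H a ->
  exists chi, [/\ character chi, forall x, H x -> chi x = 1 & chi a <> 1].
Proof.
move=> sH Ha; pose Gamma := [set p : A * C | H p.1 /\ p.2 = 1].
have pG : partial_character Gamma.
  split; rewrite /Gamma /=.
  - by split=> //; exact: sH.1.
  - by move=> x y z w [Hx ->] [Hy ->]; rewrite divr1; split=> //; exact: sH.2.
  - by move=> x z [_ ->]; exact: normc1.
  - by move=> z [].
have [zeta zeta1 comp] : exists2 zeta, zeta != 1 & compatible Gamma a zeta.
  have [[m [m0 Hm]]|free] := pselect (exists m, (0 < m)%N /\ H (a *+ m)).
    have ex : exists m, `[< (0 < m)%N /\ H (a *+ m) >].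
      by exists m; apply/asboolP.
    case: (ex_minnP ex) => k /asboolP [k0 Hk] kmin.
    have k1 : (1 < k)%N.
      by case: k k0 Hk {kmin} => [|[|k]] // _; rewrite mulr1n => /Ha.
    have [zeta zeta1 zetak] := exists_root_of_unity k1; exists zeta => //.
    apply: (compatible_root pG k0); first by split.
    by move=> j v j0 [Hj _]; apply: kmin; apply/asboolP.
  (* a has infinite order modulo H, so any value other than 1 will do *)
  exists (-1); first by rewrite -subr_eq0 -opprD oppr_eq0 -mulr2n pnatr_eq0.
  apply: compatible_free => //; first by rewrite normcN normc1.
  by move=> m t m0 [Hm _]; apply: free; exists m.
have [chi chiP chiE] := extend_partial_character (partial_character_extend pG comp).
exists chi; split=> //.
  by move=> x Hx; apply: chiE; apply: extend_sub.
rewrite (chiE a zeta); first exact/eqP.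
by apply: extend_mem; case: pG.
Qed.

End Characters.

(** * Group topologies given by the cost of generators *)

Section Words.
Context (J : Type).

(** The formal difference of the generators in the two lists. *)
Definition word : Type := seq J * seq J.

Definition word_sum (V : zmodType) (F : J -> V) (l : word) : V :=
  \sum_(j <- l.1) F j - \sum_(j <- l.2) F j.

Definition word_cat (l m : word) : word := (l.1 ++ m.1, l.2 ++ m.2).

Lemma word_sum_cat (V : zmodType) (F : J -> V) l m :
  word_sum F (word_cat l m) = word_sum F l + word_sum F m.
Proof. by rewrite /word_sum !big_cat opprD addrACA. Qed.

Lemma word_sum_opp (V : zmodType) (F : J -> V) l :
  word_sum F (l.2, l.1) = - word_sum F l.
Proof. by rewrite /word_sum opprB. Qed.

End Words.

Section CostTopology.
Context (R : realType) (A : zmodType) (J : Type) (g : J -> A) (c : J -> R).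

Definition word_cost (l : word J) : R := \sum_(j <- l.1 ++ l.2) c j.

Lemma word_cost_cat l m : word_cost (word_cat l m) = word_cost l + word_cost m.
Proof. by rewrite /word_cost !big_cat /=; ring. Qed.

Lemma word_cost_opp l : word_cost (l.2, l.1) = word_cost l.
Proof. by rewrite /word_cost !big_cat /= addrC. Qed.

Definition cost_ball (e : R) : set A :=
  [set x | exists l, word_cost l < e /\ word_sum g l = x].

Lemma cost_ball0 e : 0 < e -> cost_ball e 0.
Proof.
by move=> e0; exists ([::], [::]); rewrite /word_cost /word_sum /= !big_nil subrr.
Qed.

Lemma cost_ballN e x : cost_ball e x -> cost_ball e (- x).
Proof.
by move=> [l [le <-]]; exists (l.2, l.1); rewrite word_cost_opp word_sum_opp.
Qed.

Lemma cost_ballD e d x y : cost_ball e x -> cost_ball d y ->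
  cost_ball (e + d) (x + y).
Proof.
move=> [l [le <-]] [m [md <-]]; exists (word_cat l m).
by rewrite word_cost_cat word_sum_cat ltrD.
Qed.

Lemma cost_ball_half e x y : cost_ball (e / 2) x -> cost_ball (e / 2) y ->
  cost_ball e (x + y).
Proof. by move=> xe ye; rewrite [e]splitr; exact: cost_ballD. Qed.

Lemma sub_cost_ball e d : e <= d -> cost_ball e `<=` cost_ball d.
Proof. by move=> ed _ [l [le <-]]; exists l; rewrite (lt_le_trans le). Qed.

Lemma cost_ball_gen e j : c j < e -> cost_ball e (g j).
Proof.
move=> ce; exists ([:: j], [::]).
by rewrite /word_cost /word_sum /= !big_seq1 big_nil subr0.
Qed.

Definition cost_space : Type := Algebra.to_multiplicative A.
HB.instance Definition _ := Choice.on cost_space.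

Definition cost_nbhs (x : A) : set_system A :=
  [set N | exists2 e : R, 0 < e & forall y, cost_ball e y -> N (x + y)].

HB.instance Definition _ := hasNbhs.Build cost_space cost_nbhs.

Lemma cost_nbhsE (x : cost_space) (N : set cost_space) : nbhs x N =
  exists2 e : R, 0 < e & forall y : A, cost_ball e y -> N ((x : A) + y).
Proof. by []. Qed.

Fact cost_nbhs_filter (x : cost_space) : ProperFilter (nbhs x).
Proof.
split; first by rewrite cost_nbhsE => -[e e0]; apply; exact: cost_ball0.
split=> [|P Q|P Q PQ]; rewrite !cost_nbhsE.
- by exists 1.
- move=> [e e0 eP] [d d0 dQ]; exists (Num.min e d); first by rewrite lt_min e0.
  move=> y yb; split; [apply: eP|apply: dQ]; apply: sub_cost_ball yb.
    by rewrite ge_min lexx.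
  by rewrite ge_min lexx orbT.
- by move=> [e e0 eP]; exists e => // y /eP; exact: PQ.
Qed.

Fact cost_nbhs_singleton (x : cost_space) (N : set cost_space) :
  nbhs x N -> N x.
Proof.
rewrite cost_nbhsE => -[e e0 /(_ 0)]; rewrite addr0; apply; exact: cost_ball0.
Qed.

Fact cost_nbhs_nbhs (x : cost_space) (N : set cost_space) :
  nbhs x N -> nbhs x (nbhs^~ N).
Proof.
rewrite !cost_nbhsE => -[e e0 eN]; have e20 : 0 < e / 2 by rewrite divr_gt0.
exists (e / 2) => // y ye; rewrite cost_nbhsE; exists (e / 2) => // z ze.
by rewrite -addrA; apply: eN; exact: cost_ball_half.
Qed.

HB.instance Definition _ := Nbhs_isNbhsTopological.Build cost_space
  cost_nbhs_filter cost_nbhs_singleton cost_nbhs_nbhs.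

Definition cost_topology : Topological (Algebra.to_multiplicative A) :=
  Topological.on cost_space.

Lemma cost_group_topology : group_topology cost_topology.
Proof.
split.
  move=> [x y] N; rewrite [X in X -> _]cost_nbhsE /= => -[e e0 eN].
  have e20 : 0 < e / 2 by rewrite divr_gt0.
  exists ([set z | exists2 u, cost_ball (e / 2) u & z = (x : A) + u],
          [set z | exists2 u, cost_ball (e / 2) u & z = (y : A) + u]) => /=.
    by split; rewrite cost_nbhsE; exists (e / 2) => // u ue; exists u.
  move=> [x' y'] /= [[u ue ->] [v ve ->]].
  have := eN _ (cost_ball_half ue ve); congr N; rewrite /mul/= /= addrACA //.
move=> x N; rewrite [X in X -> _]cost_nbhsE => -[e e0 eN].
rewrite /nbhs /=; exists e => // y /cost_ballN /eN; congr N.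
by rewrite /= -[RHS]/(- ((x : A) + y)) opprD.
Qed.

Lemma cost_hausdorff : (forall x, (forall e, 0 < e -> cost_ball e x) -> x = 0) ->
  hausdorff_space (space cost_topology).
Proof.
move=> sep x y xy; have xyW : forall e, 0 < e -> cost_ball e ((x : A) - y).
  move=> e e0; have e20 : 0 < e / 2 by rewrite divr_gt0.
  have xN : nbhs (x : cost_space)
      [set z | exists2 u, cost_ball (e / 2) u & z = (x : A) + u].
    by rewrite cost_nbhsE; exists (e / 2) => // u ue; exists u.
  have yN : nbhs (y : cost_space)
      [set z | exists2 u, cost_ball (e / 2) u & z = (y : A) + u].
    by rewrite cost_nbhsE; exists (e / 2) => // u ue; exists u.
  have [_ [[u ue ->] [v ve E]]] := xy _ _ xN yN.
  have -> : (x : A) - y = v - u.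
    have {1}-> : (x : A) = y + v - u by rewrite -E addrK.
    by rewrite addrC !addrA addNr add0r.
  by apply: cost_ball_half => //; exact: cost_ballN.
by apply/eqP; rewrite -subr_eq0; apply/eqP; exact: sep.
Qed.

Lemma normc_mul_sub1 (z w : R[i]) : normc z = 1 ->
  normc (z * w - 1) <= normc (z - 1) + normc (w - 1).
Proof.
move=> z1; have -> : z * w - 1 = (z - 1) + z * (w - 1) by ring.
by apply: le_trans (le_normcD _ _) _; rewrite normcM z1 mul1r.
Qed.

Lemma normc_inv_sub1 (z : R[i]) : normc z = 1 ->
  normc (z^-1 - 1) = normc (z - 1).
Proof.
move=> z1; have z0 := normc1_neq0 z1.
have -> : z^-1 - 1 = - (z - 1) / z by rewrite mulNr mulrBl mul1r divff // opprB.
by rewrite normcM normcN normcV z1 invr1 mulr1.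
Qed.

Lemma character0 (chi : A -> R[i]) : character chi -> chi 0 = 1.
Proof.
move=> [chi1 chiD]; have := chiD 0 0; rewrite addr0 => e.
apply: (@mulfI _ (chi 0)); first exact: normc1_neq0.
by rewrite mulr1 -e.
Qed.

Lemma characterN (chi : A -> R[i]) x : character chi -> chi (- x) = (chi x)^-1.
Proof.
move=> chiP; have [chi1 chiD] := chiP; have nz := normc1_neq0 (chi1 x).
by apply: (mulfI nz); rewrite -chiD addrN character0 // divff.
Qed.

(** The bound is only required on generators; it extends to all words because
    the distance to 1 is subadditive on the circle. *)
Definition lipschitz_character (chi : A -> R[i]) : Prop :=
  exists2 M : R, 0 <= M & forall j, normc (chi (g j) - 1) <= M * c j.

Lemma lipschitz_word_sum (chi : A -> R[i]) M : character chi ->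
  (forall j, normc (chi (g j) - 1) <= M * c j) ->
  forall l, normc (chi (word_sum g l) - 1) <= M * word_cost l.
Proof.
move=> chiP chiM l; have [chi1 chiD] := chiP.
have sumP s : normc (chi (\sum_(j <- s) g j) - 1) <= M * \sum_(j <- s) c j.
  elim: s => [|j s IH]; first by rewrite !big_nil character0 // subrr normc0 mulr0.
  rewrite !big_cons chiD mulrDr; apply: le_trans (normc_mul_sub1 _ (chi1 _)) _.
  by rewrite lerD.
rewrite /word_sum /word_cost big_cat mulrDr chiD characterN //.
apply: le_trans (normc_mul_sub1 _ (chi1 _)) _.
by rewrite normc_inv_sub1 // lerD.
Qed.

Lemma lipschitz_character_ball (chi : A -> R[i]) x : character chi ->
  lipschitz_character chi -> (forall e, 0 < e -> cost_ball e x) -> chi x = 1.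
Proof.
move=> chiP [M M0 chiM] xW; apply/eqP; rewrite -subr_eq0; apply/eqP/eq0_normc.
apply/eqP; rewrite eq_le; apply/andP; split; last first.
  by case: (_ - 1) => a b; rewrite sqrtr_ge0.
apply/ler_addgt0Pr => e e0; rewrite add0r.
have d0 : 0 < e / (M + 1) by rewrite divr_gt0 // ltr_wpDl.
have [l [ld <-]] := xW _ d0.
apply: le_trans (lipschitz_word_sum chiP chiM l) _.
apply: (@le_trans _ _ (M * (e / (M + 1)))); first by rewrite ler_wpM2l // ltW.
rewrite mulrCA -[leRHS]mulr1 ler_wpM2l ?ltW // ?ltr_pdivrMr ?mul1r ?ltrDl //.
by rewrite ltr_wpDl.
Qed.

Definition circle_character (chi : A -> R[i]) (chiP : character chi) :
    Algebra.to_multiplicative A -> circle R :=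
  fun x => @Circle R (chi x) (introT eqP (chiP.1 x)).

Lemma lipschitz_compactification_map (chi : A -> R[i]) (chiP : character chi) :
  lipschitz_character chi ->
  compactification_map cost_topology (circle_topology R) (circle_character chiP).
Proof.
move=> [M M0 chiM]; have [chi1 chiD] := chiP; split.
  split; last exact: circle_compact.
  by split; [exact: circle_group_topology|exact: circle_hausdorff].
split; first by move=> x y; apply: val_inj; rewrite /= -chiD.
move=> x N /nbhs_circle [e e0 eN].
have d0 : 0 < e / (M + 1) by rewrite divr_gt0 // ltr_wpDl.
rewrite /nbhs /=; exists (e / (M + 1)) => // _ [l [ld <-]]; apply: eN => /=.
have -> : chi ((x : A) + word_sum g l) - chi x =
    chi x * (chi (word_sum g l) - 1) by rewrite chiD; ring.
rewrite normcM chi1 mul1r; apply: le_lt_trans (lipschitz_word_sum chiP chiM l) _.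
apply: (@le_lt_trans _ _ (M * (e / (M + 1)))); first by rewrite ler_wpM2l // ltW.
by rewrite mulrCA -[ltRHS]mulr1 ltr_pM2l // ltr_pdivrMr ?mul1r ?ltrDl // ltr_wpDl.
Qed.

End CostTopology.

(** * Shift graphs *)

Section WordSumTheory.
Context (J : eqType).
Implicit Types l : word J.

Lemma eq_in_word_sum (V : zmodType) (F G : J -> V) l :
  {in l.1 ++ l.2, F =1 G} -> word_sum F l = word_sum G l.
Proof.
move=> FG; rewrite /word_sum; congr (_ - _); apply: eq_big_seq => j jl;
  by apply: FG; rewrite mem_cat jl ?orbT.
Qed.

Lemma word_sumD (V : zmodType) (F G : J -> V) l :
  word_sum (fun j => F j + G j) l = word_sum F l + word_sum G l.
Proof. by rewrite /word_sum !big_split /= opprD addrACA. Qed.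

Lemma word_sum_sum (V : zmodType) (I : Type) (s : seq I) (F : I -> J -> V) l :
  word_sum (fun j => \sum_(i <- s) F i j) l = \sum_(i <- s) word_sum (F i) l.
Proof. by rewrite /word_sum sumrB; congr (_ - _); rewrite exchange_big. Qed.

Lemma word_sum_mulrz (V : zmodType) (x : V) (k : J -> int) l :
  word_sum (fun j => x *~ k j) l = x *~ word_sum k l.
Proof. by rewrite /word_sum mulrzBr -!mulrz_sumr. Qed.

Lemma norm_word_sum (k : J -> int) (P : pred J) l :
  (forall j, `|k j| <= (P j : int)) -> `|word_sum k l| <= count P (l.1 ++ l.2).
Proof.
move=> kP; have sumP s : `|\sum_(j <- s) k j| <= count P s.
  elim: s => [|j s IH]; first by rewrite big_nil normr0.
  by rewrite big_cons /= PoszD; apply: le_trans (ler_normD _ _) _; rewrite lerD.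
by rewrite count_cat PoszD; apply: le_trans (ler_normB _ _) _; rewrite lerD.
Qed.

End WordSumTheory.

(** The triple (a, y, b) stands for the increasing sequence a, y, b, read as the
    edge from (a, y) to (y, b). *)
Record edge := Edge {
  edge_val :> nat * seq nat * nat;
  edgeP : sorted ltn (edge_val.1.1 :: rcons edge_val.1.2 edge_val.2) }.
HB.instance Definition _ := [isSub for edge_val].
HB.instance Definition _ := [Equality of edge by <:].

Definition edge_mid (j : edge) : seq nat := j.1.2.
Definition edge_src (j : edge) : seq nat := j.1.1 :: j.1.2.
Definition edge_tgt (j : edge) : seq nat := rcons j.1.2 j.2.

Lemma size_edge_src j : size (edge_src j) = (size (edge_mid j)).+1.
Proof. by []. Qed.
Lemma size_edge_tgt j : size (edge_tgt j) = (size (edge_mid j)).+1.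
Proof. by rewrite size_rcons. Qed.

Lemma uniq_edge_mid j : uniq (edge_mid j).
Proof.
have := sorted_uniq ltn_trans ltnn (edgeP j).
by rewrite /edge_mid /= rcons_uniq => /andP[_ /andP[]].
Qed.

(** Induction on the length.  From a colouring of the sequences of length k + 2
    one colours a sequence of length k + 1 by the set of colours of its
    one-point extensions.  If (a, y) and (y, b) get the same set, then the
    colour of (a, y, b) is also the colour of some (y, b, d), and
    (a, y, b) -> (y, b, d) is an edge.  Length 1 is the pigeonhole principle. *)
Lemma monochromatic_edge (k : nat) : forall (C : finType) (chi : seq nat -> C),
  exists2 j : edge, size (edge_mid j) = k & chi (edge_src j) = chi (edge_tgt j).
Proof.
elim: k => [|k IH] C chi.
  have /injectivePn [x [y xy e]] :
      ~~ injectiveb [ffun i : 'I_#|C|.+1 => chi [:: i : nat]].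
    apply/negP => /injectiveP inj.
    by have := leq_card _ inj; rewrite card_ord ltnn.
  wlog lt_xy : x y xy e / (x < y)%N.
    move=> H; have [lt|lt|E] := ltngtP x y; first exact: H xy e lt.
      by apply: (H y x) => //; rewrite eq_sym.
    by move/eqP: xy; case; apply: val_inj.
  have jP : sorted ltn ((x : nat) :: rcons [::] (y : nat)) by rewrite /= lt_xy.
  exists (@Edge (x : nat, [::], y : nat) jP) => //.
  by move: e; rewrite !ffunE.
pose chi' v : {ffun C -> bool} :=
  [ffun c => `[< exists b, sorted ltn (rcons v b) /\ chi (rcons v b) = c >]].
have [[[[a y] b] /= jP] /= yk] := IH _ chi'.
rewrite /edge_src /edge_tgt /= => E.
have : chi' (a :: y) (chi (a :: rcons y b)).
  by rewrite ffunE; apply/asboolP; exists b; split.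
rewrite E ffunE => /asboolP [d [sd ed]].
have jP' : sorted ltn (a :: rcons (rcons y b) d).
  move: (jP) sd; case: (y) => [|z t] /=; first by move=> /andP[-> _].
  by move=> /andP[-> _].
exists (@Edge (a, rcons y b, d) jP').
  by rewrite /edge_mid /= size_rcons; congr _.+1.
by rewrite /edge_src /edge_tgt /= ed.
Qed.

Section Potential.
Context (l : seq edge).

Definition edges_of_size (m : nat) : seq edge :=
  [seq j <- l | size (edge_mid j) == m].

(** The values at which the two ends of an edge can differ. *)
Definition end_values (m : nat) : seq nat :=
  [seq j.1.1 | j : edge <- edges_of_size m] ++ [seq j.2 | j : edge <- edges_of_size m].

(** Position of the first value that is not an end value of an edge of l of the
    relevant size.  The two ends (a, y) and (y, b) of an edge have the same such
    values, all of them in y, and each occurs one place earlier in (y, b). *)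
Definition potential (v : seq nat) : nat :=
  find (predC (mem (end_values (size v).-1))) v.

(** The sequence y has no repetitions and is longer than the list of end values,
    so it contains a value that is not among them. *)
Lemma potential_edge j : j \in l ->
  (2 * count (fun i => size (edge_mid i) == size (edge_mid j)) l
     < size (edge_mid j))%N ->
  potential (edge_src j) = (potential (edge_tgt j)).+1.
Proof.
move=> jl small; rewrite /potential size_edge_src size_edge_tgt.
set E := end_values _.
have jE : j \in edges_of_size (size (edge_mid j)) by rewrite mem_filter eqxx.
have aE : j.1.1 \in E.
  by rewrite mem_cat; apply/orP; left; apply/mapP; exists j.
have hasE : has (predC (mem E)) (edge_mid j).
  rewrite -[has _ _]negbK -all_predC; apply/negP => /allP allE.
  have sub : {subset edge_mid j <= E} by move=> x /allE /=; rewrite negbK.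
  have := uniq_leq_size (uniq_edge_mid j) sub.
  rewrite size_cat !size_map size_filter addnn -mul2n.
  by rewrite leqNgt small.
have -> : edge_src j = j.1.1 :: edge_mid j by [].
by rewrite /= aE /edge_tgt -/(edge_mid j) -cats1 find_cat hasE.
Qed.

End Potential.

Section EdgeCost.
Context (R : realType) (A : zmodType) (e0 : A) (s : seq nat -> A).

Definition edge_gen (j : edge) : A := e0 + (s (edge_src j) - s (edge_tgt j)).

Definition edge_cost (j : edge) : R := 3 / (size (edge_mid j)).+1%:R.

(** The constant 3 in the cost leaves room for the two end values of each edge
    when the sequences have size m. *)
Lemma edge_count (l : word edge) m : word_cost edge_cost l < 1 ->
  (3 * count (fun j => size (edge_mid j) == m) (l.1 ++ l.2) < m.+1)%N.
Proof.
move=> cost1; rewrite -(ltr_nat R) natrM.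
set q := count _ _; have m0 : 0 < (m.+1)%:R :> R by rewrite ltr0n.
suff : q%:R * (3 / m.+1%:R) < 1 :> R by rewrite mulrA ltr_pdivrMr // mul1r mulrC.
apply: le_lt_trans cost1; rewrite /word_cost /q; elim: (l.1 ++ l.2) => [|j t IH].
  by rewrite big_nil mul0r.
rewrite big_cons /= natrD mulrDl lerD // /edge_cost; case: eqVneq => [->|_].
  by rewrite mul1r.
by rewrite mul0r divr_ge0.
Qed.

Definition vertices (l : word edge) : seq (seq nat) :=
  undup ([seq edge_src j | j <- l.1 ++ l.2] ++ [seq edge_tgt j | j <- l.1 ++ l.2]).

Definition degree (l : word edge) (v : seq nat) : int :=
  word_sum (fun j => ((edge_src j == v) : int) - ((edge_tgt j == v) : int)) l.

(** Summation by parts on the graph of the word. *)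
Lemma word_sum_coboundary (V : zmodType) (F : seq nat -> V) l :
  word_sum (fun j => F (edge_src j) - F (edge_tgt j)) l =
  \sum_(v <- vertices l) F v *~ degree l v.
Proof.
under eq_bigr do rewrite /degree -word_sum_mulrz.
rewrite -word_sum_sum; apply: eq_in_word_sum => j jl.
have pick u : u \in vertices l -> F u = \sum_(v <- vertices l) F v *~ ((u == v) : int).
  move=> ul; rewrite (bigD1_seq u) ?undup_uniq //= eqxx mulr1z big1 ?addr0 // => v vu.
  by rewrite eq_sym (negPf vu) mulr0z.
rewrite [in LHS](pick (edge_src j)); last first.
  by rewrite mem_undup mem_cat map_f.
rewrite [in LHS](pick (edge_tgt j)); last first.
  by rewrite mem_undup mem_cat map_f ?orbT.
by rewrite -sumrB; apply: eq_bigr => v _; rewrite mulrzBr.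
Qed.

Lemma degree_bound l v : word_cost edge_cost l < 1 -> (`|degree l v| <= size v)%N.
Proof.
move=> cost1; case: (posnP (size v)) => [v0|v0].
  have := @norm_word_sum _ (fun j => ((edge_src j == v) : int) - ((edge_tgt j == v) : int)) pred0 l.
  rewrite count_pred0 v0 -lez_nat => H; apply: H => j.
  have [jv|_] := eqVneq; first by move: v0; rewrite -jv size_edge_src.
  have [jv|//] := eqVneq; by move: v0; rewrite -jv size_edge_tgt.
have := @norm_word_sum _ (fun j => ((edge_src j == v) : int) - ((edge_tgt j == v) : int))
  (fun j => size (edge_mid j) == (size v).-1) l.
have := edge_count (size v).-1 cost1.
rewrite prednK // => cnt H; rewrite -lez_nat; apply: le_trans (H _) _; last first.
  by rewrite lez_nat; apply: leq_trans (ltnW cnt); rewrite leq_pmull.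
move=> j; have [jv|_] := eqVneq.
  rewrite -jv size_edge_src eqxx; by case: eqVneq.
have [jv|_] := eqVneq; last by case: eqVneq.
by rewrite -jv size_edge_tgt eqxx.
Qed.

Lemma word_sum_one (l : word edge) : word_cost edge_cost l < 1 ->
  word_sum (fun=> 1 : int) l =
  \sum_(v <- vertices l) (potential (l.1 ++ l.2) v : int) *~ degree l v.
Proof.
move=> cost1; rewrite -word_sum_coboundary; apply: eq_in_word_sum => j jl.
rewrite (@potential_edge _ j) //; first by rewrite -addn1 PoszD addrAC subrr add0r.
have := edge_count (size (edge_mid j)) cost1.
have : (0 < count (fun i => size (edge_mid i) == size (edge_mid j)) (l.1 ++ l.2))%N.
  by rewrite -has_count; apply/hasP; exists j.
lia.
Qed.

(** The family satisfies only trivial relations with coefficients bounded by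
    the length of the index; a relation counts as trivial when each
    coefficient annihilates the term of the family and e0. *)
Definition independent : Prop :=
  forall (V : seq (seq nat)) (d : seq nat -> int) (n : int), uniq V ->
    (forall v, `|d v| <= size v)%N ->
    e0 *~ n + \sum_(v <- V) s v *~ d v = 0 ->
    forall v, v \in V -> s v *~ d v = 0 /\ e0 *~ d v = 0.

(** Independence shows that every degree annihilates e0, and the number of
    occurrences of e0 in the word is the sum of the degrees against the
    potential. *)
Lemma multiple_in_unit_ball_eq0 n : independent ->
  cost_ball edge_gen edge_cost 1 (e0 *~ n) -> e0 *~ n = 0.
Proof.
move=> ind [l [cost1]].
have -> : word_sum edge_gen l = e0 *~ word_sum (fun=> 1) l +
    \sum_(v <- vertices l) s v *~ degree l v.
  by rewrite -word_sum_coboundary -word_sum_mulrz -word_sumD.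
move=> E.
have deg0 v : v \in vertices l -> s v *~ degree l v = 0 /\ e0 *~ degree l v = 0.
  apply: (ind _ (degree l) (word_sum (fun=> 1) l - n)) => //.
  - exact: undup_uniq.
  - by move=> u; exact: degree_bound.
  - by rewrite mulrzBr addrAC E subrr.
rewrite -E big_seq big1 ?addr0 => [|v /deg0 [] //].
rewrite word_sum_one // mulrz_sumr big_seq big1 // => v /deg0 [_ dv].
by rewrite mulrzz mulrC mulrzA dv mul0rz.
Qed.

End EdgeCost.

(** * Homomorphisms to compact groups *)

Section Coloring.
Local Open Scope group_scope.

(** The colour of x is a centre k of a translate k V that contains x, where V is
    such that quotients of elements of V lie in U. *)
Lemma compact_coloring (K : groupType) (kappa : Topological K) (U : set K) :
  compact_hausdorff_group_topology kappa -> nbhs (1 : space kappa) U ->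
  exists (C : finType) (col : K -> C),
    forall x y, col x = col y -> U (x^-1 * y).
Proof.
move=> [[[cM cV] _] cptK] U1.
have [V V1 VU] : exists2 V : set K, nbhs (1 : space kappa) V &
    forall x y, V x -> V y -> U (x^-1 * y).
  have : nbhs ((1 : K)^-1 * 1 : space kappa) U by rewrite invg1 mulg1.
  move=> /(cM ((1 : K)^-1, 1)) [[P Q] /= [/cV P1 Q1] PQ].
  exists ([set x | P x^-1] `&` Q).
    exact: (@filterI _ _ (nbhs_filter (1 : space kappa))).
  by move=> x y [Px _] [_ Qy]; exact: (PQ (x^-1, y)).
pose f (k : space kappa) : set (space kappa) :=
  interior [set y : space kappa | V ((k : K)^-1 * (y : K))].
have fk k : f k k.
  have : nbhs ((k : K)^-1 * (k : K) : space kappa) V by rewrite mulVg.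
  move=> /(cM ((k : K)^-1, k)) [[P Q] /= [Pk Qk] PQ].
  apply: (@filterS _ _ (nbhs_filter (k : space kappa))) Qk => y Qy.
  apply: (PQ ((k : K)^-1, y)); split=> //=.
  exact: (@nbhs_singleton (space kappa)) Pk.
pose pK : ptopologicalType :=
  HB.pack (space kappa) (isPointed.Build (space kappa) (1 : K)).
move: cptK; rewrite -[compact _]/(@compact pK _) (@compact_cover pK) => /(_ _ setT f) [].
- by move=> k _; exact: open_interior.
- by move=> k _; exists k.
move=> D _ Dcov.
have /choice [col colP] : forall y : space kappa, exists k : D, f (val k) y.
  by move=> y; have [k kD fky] := Dcov y I; exists [` kD]%fset.
exists D, col => x y xy.
have Vx := interior_subset (colP x); have Vy := interior_subset (colP y).
rewrite -xy in Vy; have := VU _ _ Vx Vy.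
by rewrite invgM invgK mulgA mulgK.
Qed.
End Coloring.

Section Killing.
Context (R : realType) (A : zmodType) (e0 : A) (s : seq nat -> A).
Notation tau := (cost_topology (edge_gen e0 s) (@edge_cost R)).

Lemma edge_cost_small (e : R) : 0 < e ->
  exists k, forall j, size (edge_mid j) = k -> @edge_cost R j < e.
Proof.
move=> e0'; exists (Num.bound (3 / e)) => j jk; rewrite /edge_cost jk.
rewrite ltr_pdivrMr ?ltr0n // mulrC -ltr_pdivrMr //.
by apply: lt_trans (archi_boundP _) _; [rewrite divr_ge0 // ltW|rewrite ltr_nat].
Qed.

(** On a monochromatic edge u -> v of small cost, s v - s u = e0 - g with g a
    small generator, so f (s v - s u) is close both to 1 and to f e0. *)
Lemma compactification_map_kills (K : groupType) (kappa : Topological K)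
    (f : Algebra.to_multiplicative A -> K) :
  compactification_map tau kappa f -> f e0 = 1%g.
Proof.
move=> [cptK [fM fC]]; have [[_ hK] _] := cptK.
have fD (x y : A) : f (x + y) = (f x * f y)%g by exact: fM.
apply: hK => U V Ue V1.
have [C [col colP]] := compact_coloring cptK V1.
have [e egt0 eU] := fC e0 _ Ue.
have [k kP] := edge_cost_small egt0.
have [j jk jcol] := monochromatic_edge k (fun v => col (f (s v))).
exists (f (s (edge_tgt j) - s (edge_src j))); split; last first.
  have fN (x : A) : f (- x) = (f x)^-1%g by exact: (group_homV fM x).
  by rewrite addrC fD fN; exact: colP jcol.
have := eU _ (cost_ballN (cost_ball_gen (edge_gen e0 s) (kP j jk))).
by congr (U (f _)); rewrite /edge_gen opprD addrA subrr sub0r opprB.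
Qed.

End Killing.

(** * Independent families on which characters are small *)

Lemma infinite_fiber (T : Type) (C : finType) (B : set T) (col : T -> C) :
  infinite_set B -> exists c, infinite_set (B `&` [set x | col x = c]).
Proof.
move=> Binf; apply: contrapT => H; apply: Binf.
apply: (@sub_finite_set _ _ (\bigcup_(c in [set: C]) (B `&` [set x | col x = c]))).
  by move=> x Bx; exists (col x).
apply: bigcup_finite; first exact: finite_finset.
by move=> c _; apply: contrapT => Hc; apply: H; exists c.
Qed.

(** Multiplication by n either vanishes on X or is finite-to-one on X; an
    element x of X that avoids finitely many finite sets then satisfies no
    relation whose x-coefficient is bounded, except a trivial one. *)
Definition kills_or_finite_kernel (A : zmodType) (X : set A) : Prop :=
  forall n, (0 < n)%N ->
  (forall x, X x -> x *+ n = 0) \/ finite_set [set x | X x /\ x *+ n = 0].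

Section Selection.
Context (R : realType) (A : zmodType).
Implicit Types (B : set A) (chi : A -> R[i]).

(** Two elements of B with the same colours under finitely many characters have
    a difference on which these characters are close to 1; infinitely many
    elements share their colours. *)
Lemma infinite_small_values B (chi : nat -> A -> R[i]) (k : nat) (e : R) :
  subgroup B -> infinite_set B -> (forall i, character (chi i)) -> 0 < e ->
  infinite_set [set x | B x /\
    forall i, (i <= k)%N -> normc (chi i x - 1) <= e].
Proof.
move=> sB Binf chiP egt0.
have cpt : compact_hausdorff_group_topology (circle_topology R).
  split; last exact: circle_compact.
  by split; [exact: circle_group_topology|exact: circle_hausdorff].
have U1 : nbhs (1%g : circle R) [set z : circle R | normc (val z - 1) <= e].
  by apply/nbhs_circle; exists e => // w; exact: ltW.
have [C [col colP]] := compact_coloring cpt U1.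
pose col' x := [ffun i : 'I_k.+1 => col (circle_character (chiP i) x)].
have [c cinf] := infinite_fiber col' Binf.
have [x0 [Bx0 cx0]] : (B `&` [set x | col' x = c]) !=set0.
  by apply/set0P/eqP => c0; apply: cinf; rewrite c0; exact: finite_set0.
apply: contra_not cinf => fin.
apply: (@sub_finite_set _ _ ((fun x => x + x0) @` [set x | B x /\
    forall i, (i <= k)%N -> normc (chi i x - 1) <= e])).
  move=> x [Bx cx]; exists (x - x0); last by rewrite subrK.
  split; first exact: sB.2.
  move=> i ik; have := congr1 (fun h : {ffun _} => h (Ordinal (ik : (i < k.+1)%N))) cx0.
  rewrite -[in RHS]cx /= !ffunE /= => /colP /=.
  by rewrite (chiP i).2 characterN // mulrC.
exact: finite_image.
Qed.

Context (B : set A) (e0 : A) (chi : nat -> A -> R[i]).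
Context (sB : subgroup B) (Binf : infinite_set B).
Context (Btor : B `<=` torsion_subgroup A) (Bker : kills_or_finite_kernel B).
Context (Be0 : B e0) (chiP : forall i, character (chi i)).

Lemma finite_multiples x : B x -> finite_set [set x *~ n | n in [set: int]].
Proof.
move=> /Btor [n n0 xn].
apply: (@sub_finite_set _ _ ((fun k : nat => x *+ k) @` `I_n)).
  move=> _ [k _ <-]; have nz : (n : int) != 0 by case: (n) n0.
  have := divz_eq k n; have := modz_ge0 k nz; have := ltz_mod k nz.
  case: (k %% n)%Z => // r rn _ ->; exists r => //.
  by rewrite mulrzDr mulrC mulrzA -!pmulrn xn mul0rz add0r.
exact/finite_image/finite_II.
Qed.

(** The subgroup generated by e0 and l. *)
Fixpoint span (l : seq A) : set A :=
  if l is a :: l' then [set x + y | x in span l' & y in [set a *~ n | n in [set: int]]]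
  else [set e0 *~ n | n in [set: int]].

Lemma finite_span l : (forall x, x \in l -> B x) -> finite_set (span l).
Proof.
elim: l => [|a l IH] Bl /=; first exact: finite_multiples.
apply: finite_image2; last by apply: finite_multiples; apply: Bl; rewrite mem_head.
by apply: IH => x xl; apply: Bl; rewrite in_cons xl orbT.
Qed.

Lemma finite_fiber n (F : set A) : (0 < n)%N -> finite_set F ->
  (forall x, B x -> x *+ n = 0) \/ finite_set [set x | B x /\ F (x *+ n)].
Proof.
move=> n0 Ffin; have [|kfin] := Bker n0; [by left|right].
apply: (@sub_finite_set _ _ (\bigcup_(y in F) [set x | B x /\ x *+ n = y])).
  by move=> x [Bx Fx]; exists (x *+ n).
apply: bigcup_finite => // y _.
have [[x0 [Bx0 x0n]]|none] := pselect (exists x, B x /\ x *+ n = y); last first.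
  apply: (sub_finite_set _ (finite_set0 A)) => x xP; apply: none; by exists x.
apply: (@sub_finite_set _ _ ((fun x => x + x0) @` [set x | B x /\ x *+ n = 0])).
  move=> x [Bx xn]; exists (x - x0); last by rewrite subrK.
  by split; [exact: sB.2|rewrite mulrnBl xn x0n subrr].
exact: finite_image.
Qed.

(** The requirements on a new term x of the family, where l lists the previous
    ones.  The number k is the length of the index of x; it bounds the
    coefficients and the number of characters that have to be small. *)
Definition good_choice (k : nat) (l : seq A) (x : A) : Prop :=
  [/\ B x, forall i, (i <= k)%N -> normc (chi i x - 1) <= k.+1%:R^-1 &
   forall n, (n <= k)%N -> span l (x *+ n) \/ span l (- (x *+ n)) ->
     forall y, B y -> y *+ n = 0].

Lemma exists_good_choice k l : (forall x, x \in l -> B x) ->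
  exists x, good_choice k l x.
Proof.
move=> Bl; pose F := span l `|` [set - y | y in span l].
have Ffin : finite_set F.
  by rewrite /F finite_setU; split; [|apply: finite_image]; exact: finite_span.
pose bad := \bigcup_(n in [set n | (0 < n <= k)%N /\ ~ forall x, B x -> x *+ n = 0])
  [set x | B x /\ F (x *+ n)].
have badfin : finite_set bad.
  apply: bigcup_finite.
    apply: (sub_finite_set _ (finite_II k.+1)) => n [/andP[_ nk] _] /=.
    by rewrite ltnS.
  move=> n [/andP[n0 _] Hn]; by have [] := finite_fiber n0 Ffin.
have e0' : 0 < (k.+1%:R^-1 : R) by rewrite invr_gt0 ltr0n.
pose small := [set x | B x /\
  forall i, (i <= k)%N -> normc (chi i x - 1) <= k.+1%:R^-1].
have inf : infinite_set (small `\` bad).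
  exact: infinite_setD (infinite_small_values (k := k) sB Binf chiP e0') badfin.
have [x [[Bx xsmall] xgood]] : (small `\` bad) !=set0.
  by apply/set0P/eqP => S0; apply: inf; rewrite S0; exact: finite_set0.
exists x; split=> // n nk xn; apply: contrapT => Hn; apply: xgood.
have n0 : (0 < n)%N.
  by rewrite lt0n; apply/eqP => n0; apply: Hn => y _; rewrite n0 mulr0n.
exists n; first by rewrite /= n0.
split=> //; case: xn => [|xn]; [by left|right].
by exists (- (x *+ n)) => //; rewrite opprK.
Qed.

(** The terms are chosen one after the other along an enumeration of the finite
    sequences.  In a bounded relation the term with the last index lies in the
    span of the previous ones, so its coefficient kills B; it can be removed
    and the argument repeated. *)
Lemma exists_independent_family : exists s : seq nat -> A,
  [/\ forall v, B (s v),
      forall i v, (i <= size v)%N ->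
        normc (chi i (s v) - 1) <= (size v).+1%:R^-1 &
      independent e0 s].
Proof.
have /choice [next nextP] : forall kl : nat * seq A, exists x,
    (forall y, y \in kl.2 -> B y) -> good_choice kl.1 kl.2 x.
  move=> [k l]; have [Bl|nBl] := pselect (forall y, y \in l -> B y).
    by have [x xP] := exists_good_choice k Bl; exists x.
  by exists 0 => /nBl.
pose bound n := size (odflt [::] (choice.unpickle n : option (seq nat))).
pose fix build n := if n is m.+1 then next (bound m, build m) :: build m else [::].
pose sigma n := next (bound n, build n).
have Bbuild n : forall y, y \in build n -> B y.
  elim: n => [//|n IH] y; rewrite in_cons => /orP [/eqP ->|]; last exact: IH.
  by have [] := nextP (bound n, build n) IH.
have sigmaP n : good_choice (bound n) (build n) (sigma n).
  exact: (nextP (bound n, build n) (@Bbuild n)).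
pose code (v : seq nat) : nat := choice.pickle v.
have codeI : injective code := pcan_inj choice.pickleK.
pose s v := sigma (code v).
have sP v : good_choice (size v) (build (code v)) (s v).
  by have := sigmaP (code v); rewrite /bound /code choice.pickleK.
exists s; split.
- by move=> v; have [] := sP v.
- by move=> i v; have [_ + _] := sP v; exact.
move=> V d n Vu dV E.
have spanP m : span (build m) (e0 *~ n + \sum_(v <- V | (code v < m)%N) s v *~ d v).
  elim: m => [|m IH]; first by rewrite big_pred0 ?addr0 //=; exists n.
  exists (e0 *~ n + \sum_(v <- V | (code v < m)%N) s v *~ d v) => //.
  exists (sigma m *~ \sum_(v <- V | code v == m) d v); first by eexists.
  rewrite -addrA; congr (_ + _); rewrite mulrz_sumr.
  rewrite [RHS](bigID (fun v => (code v < m)%N)) /=; congr (_ + _).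
    by apply: eq_bigl => v; rewrite ltnS; case: ltngtP.
  by apply: eq_big => [v|v /eqP <- //]; rewrite ltnS; case: ltngtP.
(* downward induction on the code of v, starting above all codes in V *)
pose N := (\max_(v <- V) code v).+1.
have kill (k : nat) : forall v : seq nat, v \in V -> (N <= code v + k)%N ->
    forall y, B y -> y *~ d v = 0.
  elim: k => [|k IH] v vV.
    rewrite addn0 leqNgt ltnS; have -> // : (code v <= \max_(v <- V) code v)%N.
    by rewrite (big_rem v) //= leq_maxl.
  move=> Nk.
  have rest : \sum_(u <- V | (code v <= code u)%N) s u *~ d u = s v *~ d v.
    rewrite big_mkcond (bigD1_seq v) //= leqnn big_seq_cond.
    rewrite big1 ?addr0 // => u /andP[uV uv].
    case: ifP => // vu; apply: (IH u uV); last by have [] := sP u.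
    apply: leq_trans Nk _; rewrite addnS -addSn leq_add2r ltn_neqAle vu andbT.
    by apply: contra uv => /eqP /codeI ->.
  have sv : e0 *~ n + \sum_(u <- V | (code u < code v)%N) s u *~ d u = - (s v *~ d v).
    apply/eqP; rewrite -addr_eq0 -rest -addrA; apply/eqP; rewrite -[RHS]E.
    congr (_ + _); rewrite [RHS](bigID (fun u => (code u < code v)%N)) /=.
    by congr (_ + _); apply: eq_bigl => u; rewrite leqNgt.
  have [_ _ good] := sP v; have := spanP (code v); rewrite sv => sp.
  have := good `|d v|%N (dV v); case: (d v) sp => m /=.
    by rewrite -!pmulrn => sp H y By; apply: H => //; right.
  rewrite NegzE !mulrNz opprK -pmulrn => sp H y By.
  by rewrite mulrNz -pmulrn H ?oppr0 //; left.
move=> v vV; have kv := kill N v vV (leq_addl _ _).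
by split; apply: kv => //; have [] := sP v.
Qed.

End Selection.

(** * Countable torsion subgroups *)

Section CountableSubgroup.
Context (A : zmodType).
Implicit Types X B : set A.

Lemma mulrn_gcd (x : A) m n : x *+ m = 0 -> x *+ n = 0 -> x *+ gcdn m n = 0.
Proof.
move=> xm xn; case: (posnP m) => [->|m0]; first by rewrite gcd0n.
have [k _ /dvdnP [q E]] := Bezoutl n m0.
have : x *+ (gcdn m n + k * n) = 0 by rewrite E mulnC mulrnA xm mul0rn.
by rewrite mulrnDr mulnC mulrnA xn mul0rn addr0.
Qed.

Lemma subgroup_torsion : subgroup (torsion_subgroup A).
Proof.
split; first by exists 1%N; rewrite ?mul0rn.
move=> x y [n n0 xn] [m m0 ym]; exists (n * m)%N; first by rewrite muln_gt0 n0.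
by rewrite mulrnBl mulrnA xn mul0rn mulnC mulrnA ym mul0rn subrr.
Qed.

(** If some A[d] is infinite, the least such d works: the elements of A[d]
    killed by n form A[gcd(n, d)], which is either A[d] or finite.  Otherwise
    the whole torsion subgroup works. *)
Lemma exists_torsion_subgroup : infinite_set (torsion_subgroup A) ->
  exists X, [/\ subgroup X, infinite_set X, X `<=` torsion_subgroup A &
                kills_or_finite_kernel X].
Proof.
move=> Tinf.
have [ex|none] := pselect (exists n, (0 < n)%N /\ infinite_set [set x : A | x *+ n = 0]).
  have ex' : exists n, `[< (0 < n)%N /\ infinite_set [set x : A | x *+ n = 0] >].
    by case: ex => n nP; exists n; exact/asboolP.
  case: (ex_minnP ex') => d /asboolP [d0 dinf] dmin.
  exists [set x | x *+ d = 0]; split=> //.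
  - by split=> [|x y /= xd yd]; rewrite /= ?mul0rn // mulrnBl xd yd subrr.
  - by move=> x xd; exists d.
  move=> n n0; have [gd|gd] := eqVneq (gcdn n d) d.
    left=> x /= xd; have /dvdnP [q ->] : (d %| n)%N by rewrite -gd dvdn_gcdl.
    by rewrite mulnC mulrnA xd mul0rn.
  right; apply: contrapT => inf; move/negP: gd; apply.
  rewrite eqn_leq dvdn_leq ?dvdn_gcdr //=; apply: dmin; apply/asboolP.
  split; first by rewrite gcdn_gt0 n0.
  apply: contra_not inf; apply: sub_finite_set => x [/= xd xn].
  exact: mulrn_gcd.
exists (torsion_subgroup A); split=> //; first exact: subgroup_torsion.
move=> n n0; right; apply: contrapT => inf; apply: none; exists n; split=> //.
by apply: contra_not inf; apply: sub_finite_set => x [].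
Qed.

(** Iterated differences of values of f, indexed by a countable type; they form
    the subgroup that f generates. *)
Fixpoint difference_tree (f : nat -> A) (t : GenTree.tree nat) : A :=
  match t with
  | GenTree.Leaf n => f n
  | GenTree.Node _ [:: t1; t2] => difference_tree f t1 - difference_tree f t2
  | GenTree.Node _ _ => 0
  end.

Lemma difference_tree_sub X f t : subgroup X -> (forall n, X (f n)) ->
  X (difference_tree f t).
Proof.
move=> sX Xf; move: t; fix IH 1 => -[n|k [|t1 [|t2 [|? ?]]]] //=; try exact: sX.1.
by apply: sX.2; exact: IH.
Qed.

Lemma exists_countable_subgroup X : subgroup X -> infinite_set X ->
  exists B (g : nat -> A), [/\ subgroup B, infinite_set B, B `<=` X &
    forall x, B x -> exists n, g n = x].
Proof.
move=> sX Xinf.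
pose pA : pointedType := HB.pack A (isPointed.Build A 0).
have [f] : $|{injfun [set: nat] >-> (X : set pA)}|.
  by apply/pcard_leP; apply/infiniteP.
have Xf n : X (f n) by exact: (@funS _ _ _ _ f n I).
pose ev := difference_tree f.
exists (range ev), (fun n => odflt 0 (omap ev (choice.unpickle n))); split.
- split; first by exists (GenTree.Node 0 [::]).
  by move=> _ _ [t _ <-] [u _ <-]; exists (GenTree.Node 0 [:: t; u]).
- apply: (@sub_infinite_set _ (range f)).
    by move=> _ [n _ <-]; exists (GenTree.Leaf n).
  apply/infiniteP; have : (range f #= [set: nat])%card.
    by apply: inj_card_eq => x y _ _; apply: (@inj _ _ _ f); rewrite inE.
  by rewrite card_eq_le => /andP[].
- by move=> _ [t _ <-]; exact: difference_tree_sub.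
- by move=> _ [t _ <-]; exists (choice.pickle t); rewrite choice.pickleK.
Qed.

End CountableSubgroup.

(** * The topology *)

Section Main.
Context (R : realType) (A : zmodType).

Lemma normc_sub1_le2 (z : R[i]) : normc z = 1 -> normc (z - 1) <= 2.
Proof.
move=> z1; apply: le_trans (le_normcD _ _) _.
by rewrite normcN normc1 z1 -[2]/(1 + 1 : R).
Qed.

(** The finitely many lengths below i are covered by the factor i + 1, since
    values of characters are at distance at most 2 from 1. *)
Lemma lipschitz_edge_gen (e0 : A) (s : seq nat -> A) (chi : A -> R[i]) (i : nat) :
  character chi -> chi e0 = 1 ->
  (forall v, (i <= size v)%N -> normc (chi (s v) - 1) <= (size v).+1%:R^-1) ->
  lipschitz_character (edge_gen e0 s) (@edge_cost R) chi.
Proof.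
move=> chiP chie0 chis; have [chi1 chiD] := chiP.
exists i.+1%:R => // j; rewrite /edge_cost /edge_gen.
set m := size (edge_mid j).
have m0 : 0 < (m.+1)%:R :> R by rewrite ltr0n.
have [im|im] := leqP i m.+1; last first.
  apply: le_trans (normc_sub1_le2 (chi1 _)) _.
  rewrite mulrA ler_pdivlMr //.
  have : (m.+1 <= i.+1)%N by exact: leq_trans (ltnW im) _.
  rewrite -(ler_nat R); nra.
rewrite !chiD chie0 mul1r characterN //.
apply: le_trans (normc_mul_sub1 _ (chi1 _)) _; rewrite normc_inv_sub1 //.
have inv_le : (m.+2%:R^-1 : R) <= m.+1%:R^-1 by rewrite lef_pV2 ?posrE ?ltr0n // ler_nat.
have hs : normc (chi (s (edge_src j)) - 1) <= m.+1%:R^-1.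
  by apply: le_trans inv_le; apply: chis; rewrite size_edge_src.
have ht : normc (chi (s (edge_tgt j)) - 1) <= m.+1%:R^-1.
  by apply: le_trans inv_le; have := chis (edge_tgt j); rewrite size_edge_tgt; apply.
have minv : 0 < (m.+1%:R^-1 : R) by rewrite invr_gt0.
have i1 : 1 <= (i.+1%:R : R) by rewrite ler1n.
apply: le_trans (lerD hs ht) _; rewrite -mulr2n -[leLHS]mulr_natl mulrA.
by rewrite ler_pM2r //; lra.
Qed.

Lemma exists_almost_maximally_almost_periodic_topology :
  infinite_set (torsion_subgroup A) ->
  exists tau : Topological (Algebra.to_multiplicative A),
    almost_maximally_almost_periodic tau.
Proof.
move=> /exists_torsion_subgroup [X [sX Xinf Xtor Xker]].
have [B [g [sB Binf BX gB]]] := exists_countable_subgroup sX Xinf.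
have Btor : B `<=` torsion_subgroup A by move=> x /BX/Xtor.
have Bker : kills_or_finite_kernel B.
  move=> n /Xker [kX|fX]; [by left=> x /BX/kX|right].
  by apply: sub_finite_set fX => x [/BX].
have [e0 [Be0 e00]] : exists e0, B e0 /\ e0 <> 0.
  apply: contrapT => none; apply: Binf; apply: (sub_finite_set _ (finite_set1 (0 : A))).
  by move=> x Bx; apply: contrapT => x0; apply: none; exists x.
pose E := [set e0 *~ n | n in [set: int]].
have Efin : finite_set E by exact: finite_multiples Btor _ Be0.
have sE : subgroup E.
  split; first by exists 0.
  by move=> _ _ [n _ <-] [m _ <-]; exists (n - m); rewrite // mulrzBr.
have Ee0 : E e0 by exists 1.
have /choice [chi chiP] : forall i, exists chi : A -> R[i],
    [/\ character chi, chi e0 = 1 & ~ E (g i) -> chi (g i) <> 1].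
  move=> i; have [Eg|nEg] := pselect (E (g i)).
    exists (fun=> 1); split; [|by []|by move=> /(_ Eg)].
    by split=> [x|x y]; rewrite ?mulr1 ?normc1.
  have [chi [chiP chiE chig]] := separating_character R sE nEg.
  by exists chi; split=> //; exact: chiE.
have chic i : character (chi i) by have [] := chiP i.
have [s [Bs schi sind]] := exists_independent_family sB Binf Btor Bker Be0 chic.
(* The points of B are separated by the chi i, the others by characters
   trivial on B. *)
have sep a : ~ E a -> exists chi : A -> R[i], [/\ character chi,
    lipschitz_character (edge_gen e0 s) (@edge_cost R) chi & chi a <> 1].
  move=> nEa; have [Ba|nBa] := pselect (B a).
    have [i gi] := gB _ Ba; have [chic' chie0 chig] := chiP i.
    exists (chi i); split=> //; last by rewrite -gi; apply: chig; rewrite gi.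
    exact: (@lipschitz_edge_gen _ _ _ i chic' chie0 (schi i)).
  have [psi [psiP psiB psia]] := separating_character R sB nBa.
  exists psi; split=> //; exists 0 => // j.
  rewrite psiB ?subrr ?normc0 ?mul0r //.
  by rewrite /edge_gen; apply: subgroupD => //; apply: sB.2.
pose tau := cost_topology (edge_gen e0 s) (@edge_cost R).
have tauH : hausdorff_group_topology tau.
  split; first exact: cost_group_topology.
  apply: cost_hausdorff => x xW.
  have [[n _ xE]|nEx] := pselect (E x).
    by rewrite -xE; apply: multiple_in_unit_ball_eq0 sind _; rewrite xE; exact: xW.
  have [psi [psiP psiL psix]] := sep x nEx; case: psix.
  exact: lipschitz_character_ball psiL xW.
exists tau; split=> //.
  have e0n : von_neumann_radical tau e0.
    move=> bG sigma rho [cptG homrho _].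
    by apply: (@compactification_map_kills R); split; [exact: cptG|exact: homrho].
  by move=> radE; move: e0n; rewrite radE.
apply: sub_finite_set Efin => a an; apply: contrapT => nEa.
have [psi [psiP psiL psia]] := sep a nEa; apply: psia.
have := von_neumann_radical_compactification (lipschitz_compactification_map psiP psiL) an.
by move=> /(congr1 val).
Qed.

End Main.

(* Algebra.to_multiplicative A is the abelian group A seen as a groupType. *)
Theorem theoremA (A : zmodType)
    (infinite_torsion : infinite_set (torsion_subgroup A)) :
  exists tau : Topological (Algebra.to_multiplicative A),
    hausdorff_group_topology tau /\ almost_maximally_almost_periodic tau.
Proof.
have [tau tauP] := @exists_almost_maximally_almost_periodic_topology
  Rdefinitions.R A infinite_torsion.
by exists tau; split; [case: tauP|].
Qed.
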